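(* Let $\mathfrak g$ be a Lie algebra and let $\mathcal F$ be a commutative $\mathfrak g$-Hopf algebra. Then via the coaction of $\mathcal F$ on $U(\mathfrak g)$ (the extension of the coaction $\blacktriangledown_{\mathfrak g}$, see context) and the natural action of $U(\mathfrak g)$ on $\mathcal F$, the pair $(U(\mathfrak g),\mathcal F)$ is a matched pair of Hopf algebras. Conversely, for a commutative Hopf algebra $\mathcal F$, if $(U(\mathfrak g),\mathcal F)$ is a matched pair of Hopf algebras, then $\mathcal F$ is a $\mathfrak g$-Hopf algebra (with respect to the action and coaction obtained by restriction to $\mathfrak g$).
   Context: Everything is over $\mathbb C$; Lie algebras are finite dimensional. Sweedler notation $\Delta(h)=h_{(1)}\otimes h_{(2)}$, right coactions $u\mapsto u_{<0>}\otimes u_{<1>}$. **$\mathfrak g$-Hopf algebra.** Let $\mathfrak g$ act on a commutative Hopf algebra $\mathcal F$ by derivations, $X\triangleright f$. $\mathcal F$ is a $\mathfrak g$-Hopf algebra if: (1) there is a right coaction $\blacktriangledown_{\mathfrak g}:\mathfrak g\to\mathfrak g\otimes\mathcal F$ satisfying the structure identity of $\mathfrak g$: for a basis $X_1,\dots,X_n$ of $\mathfrak g$ with $[X_i,X_j]=\sum_kC^k_{i,j}X_k$, writing $\blacktriangledown_{\mathfrak g}(X_j)=\sum_iX_i\otimes f^i_j$ and $f^i_{j,k}:=X_k\triangleright f^i_j$, one has $f^k_{j,i}-f^k_{i,j}=\sum_{s,r}C^k_{s,r}f^r_if^s_j+\sum_lC^l_{i,j}f^k_l$ for all $i,j,k$;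 (2) $\varepsilon(X\triangleright f)=0$ and $\Delta(X\triangleright f)=X\bullet\Delta(f)$ for all $X\in\mathfrak g$, $f\in\mathcal F$, where $X\bullet(f^1\otimes f^2)=X_{<0>}\triangleright f^1\otimes X_{<1>}f^2+f^1\otimes X\triangleright f^2$. **Extension to $U(\mathfrak g)$.** The action of $\mathfrak g$ by derivations makes $\mathcal F$ a $U(\mathfrak g)$-module algebra; the coaction $\blacktriangledown_{\mathfrak g}$ is extended (this is well defined) to $\blacktriangledown:U(\mathfrak g)\to U(\mathfrak g)\otimes\mathcal F$ inductively by $\blacktriangledown(1)=1\otimes1$ and $\blacktriangledown(uv)=u_{(1)<0>}v_{<0>}\otimes u_{(1)<1>}(u_{(2)}\triangleright v_{<1>})$. **Matched pair of Hopf algebras.** Hopf algebras $\mathcal U,\mathcal F$ form a matched pair if $\mathcal F$ is a left $\mathcal U$-module algebra ($u\triangleright1=\varepsilon(u)1$, $u\triangleright(fg)=(u_{(1)}\triangleright f)(u_{(2)}\triangleright g)$), $\mathcal U$ is a right $\mathcal F$-comodule coalgebra ($u_{<0>(1)}\otimes u_{<0>(2)}\otimes u_{<1>}=u_{(1)<0>}\otimes u_{(2)<0>}\otimes u_{(1)<1>}u_{(2)<1>}$, $\varepsilon(u_{<0>})u_{<1>}=\varepsilon(u)1$), and for all $u,v\in\mathcal U$, $f\in\mathcal F$: $\varepsilon(u\triangleright f)=\varepsilon(u)\varepsilon(f)$; $\Delta(u\triangleright f)=u_{(1)<0>}\triangleright f_{(1)}\otimes u_{(1)<1>}(u_{(2)}\triangleright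 f_{(2)})$; $\blacktriangledown(1)=1\otimes1$; $\blacktriangledown(uv)=u_{(1)<0>}v_{<0>}\otimes u_{(1)<1>}(u_{(2)}\triangleright v_{<1>})$; $u_{(2)<0>}\otimes(u_{(1)}\triangleright f)u_{(2)<1>}=u_{(1)<0>}\otimes u_{(1)<1>}(u_{(2)}\triangleright f)$. *)

(* Defs.v *)
From HB Require Import structures.
From mathcomp Require Import all_boot all_order all_algebra.
From mathcomp Require Import boolp.

Set Implicit Arguments.
Unset Strict Implicit.
Unset Printing Implicit Defensive.

Import GRing.Theory.

Local Open Scope ring_scope.

Reserved Notation "v \ox w" (at level 40, left associativity).
Reserved Notation "\sw_ ( x , y <- t ) E"
  (at level 36, E at level 36, x name, y name, t at level 200,
   format "\sw_ ( x ,  y  <-  t )  E").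

Definition bilin (K : fieldType) (V W Z : lmodType K) (f : V -> W -> Z) : Prop :=
  (forall w, linear (f^~ w)) /\ (forall v, linear (f v)).

Section TensorDef.
Variables (K : fieldType) (V W : lmodType K).

(* [:: (v1, w1); ...; (vn, wn)] stands for the formal sum of the vi (x) wi, and
   [teq] is the congruence for concatenation generated by bilinearity.  *)
Inductive teq : seq (V * W) -> seq (V * W) -> Prop :=
| teq_refl s : teq s s
| teq_sym s t : teq s t -> teq t s
| teq_trans s t u : teq s t -> teq t u -> teq s u
| teq_cat s1 s2 t1 t2 : teq s1 t1 -> teq s2 t2 -> teq (s1 ++ s2) (t1 ++ t2)
| teq_catC s t : teq (s ++ t) (t ++ s)
| teq_0l w : teq [:: (0, w)] [::]
| teq_Dl v v' w : teq [:: (v + v', w)] [:: (v, w); (v', w)]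
| teq_Dr v w w' : teq [:: (v, w + w')] [:: (v, w); (v, w')]
| teq_Z a v w : teq [:: (a *: v, w)] [:: (v, a *: w)].

Definition teqb : rel (seq (V * W)) := fun s t => `[< teq s t >].

Fact teqb_refl : reflexive teqb.
Proof. by move=> s; apply/asboolP; apply: teq_refl. Qed.
Fact teqb_sym : symmetric teqb.
Proof. by move=> s t; apply/asboolP/asboolP; apply: teq_sym. Qed.
Fact teqb_trans : transitive teqb.
Proof. by move=> t s u /asboolP h /asboolP h'; apply/asboolP; apply: teq_trans h h'. Qed.

Canonical teq_equiv := EquivRel teqb teqb_refl teqb_sym teqb_trans.

Definition tensor := {eq_quot teq_equiv}%qT.
HB.instance Definition _ := Choice.on tensor.

Definition tens_of (s : seq (V * W)) : tensor := \pi_{eq_quot teq_equiv}%qT s.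
Definition trepr (t : tensor) : seq (V * W) := repr t.

Lemma tens_of_eq s t : teq s t -> tens_of s = tens_of t.
Proof. by move=> h; apply/eqmodP/asboolP. Qed.

Lemma teq_repr s : teq (trepr (tens_of s)) s.
Proof.
by have /eqmodP/asboolP := reprK (\pi_{eq_quot teq_equiv}%qT s).
Qed.

Lemma treprK t : tens_of (trepr t) = t.
Proof. exact: reprK. Qed.

Definition tens_add (x y : tensor) := tens_of (trepr x ++ trepr y).
Definition tens_zero := tens_of [::].
Definition tens_scale (a : K) (x : tensor) :=
  tens_of [seq (a *: p.1, p.2) | p <- trepr x].
Definition tens_opp := tens_scale (-1).

Lemma tens_of_cat s t : tens_of (s ++ t) = tens_add (tens_of s) (tens_of t).
Proof. by apply: tens_of_eq; apply: teq_sym; apply: teq_cat; apply: teq_repr. Qed.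

Lemma teq_scale a s t : teq s t ->
  teq [seq (a *: p.1, p.2) | p <- s] [seq (a *: p.1, p.2) | p <- t].
Proof.
elim=> {s t} [s|s t _|s t u _ h _ h'|s1 s2 t1 t2 _ h _ h'|s t|w|v v' w|v w w'|b v w].
- exact: teq_refl.
- exact: teq_sym.
- exact: teq_trans h h'.
- by rewrite !map_cat; apply: teq_cat.
- by rewrite !map_cat; apply: teq_catC.
- by rewrite /= scaler0; apply: teq_0l.
- by rewrite /= scalerDr; apply: teq_Dl.
- by apply: teq_Dr.
- by rewrite /= scalerA mulrC -scalerA; apply: teq_Z.
Qed.

Lemma tens_of_scale a s :
  tens_of [seq (a *: p.1, p.2) | p <- s] = tens_scale a (tens_of s).
Proof. by apply: tens_of_eq; apply/teq_scale/teq_sym/teq_repr. Qed.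

Fact tens_addA : associative tens_add.
Proof.
move=> x y z; rewrite -(treprK x) -(treprK y) -(treprK z).
by rewrite -!tens_of_cat catA.
Qed.
Fact tens_addC : commutative tens_add.
Proof. by move=> x y; apply: tens_of_eq; apply: teq_catC. Qed.
Fact tens_add0 : left_id tens_zero tens_add.
Proof. by move=> x; rewrite -(treprK x) -tens_of_cat. Qed.

Lemma tens_of_cons p s : tens_of (p :: s) = tens_add (tens_of [:: p]) (tens_of s).
Proof. by rewrite -tens_of_cat. Qed.

Fact tens_scaleDl x : {morph tens_scale^~ x : a b / a + b >-> tens_add a b}.
Proof.
move=> a b; rewrite -(treprK x) -!tens_of_scale.
elim: (trepr x) => [|[v w] s ih] /=; first by rewrite tens_add0.
rewrite tens_of_cons ih scalerDl (tens_of_eq (teq_Dl _ _ _)) !(tens_of_cons _ [seq _ | _ <- _]).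
rewrite (tens_of_cons _ [:: _]) -!tens_addA; congr tens_add.
by rewrite tens_addA (tens_addC (tens_of [:: _])) -tens_addA; congr tens_add.
Qed.

Fact tens_scale0 x : tens_scale 0 x = tens_zero.
Proof.
rewrite -(treprK x) -tens_of_scale; elim: (trepr x) => [|[v w] s ih] //=.
by rewrite tens_of_cons ih scale0r (tens_of_eq (teq_0l _)) tens_add0.
Qed.

Fact tens_scaleA a b x : tens_scale a (tens_scale b x) = tens_scale (a * b) x.
Proof.
rewrite -(treprK x) -!tens_of_scale -map_comp; congr tens_of.
by apply: eq_map => p /=; rewrite scalerA.
Qed.

Fact tens_scale1 : left_id 1 tens_scale.
Proof.
move=> x; rewrite -{1}(treprK x) -tens_of_scale -[RHS]treprK; congr tens_of.
by rewrite -[RHS]map_id; apply: eq_map; case=> v w /=; rewrite scale1r.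
Qed.

Fact tens_addN : left_inverse tens_zero tens_opp tens_add.
Proof.
by move=> x; rewrite -{2}(tens_scale1 x) -tens_scaleDl addNr tens_scale0.
Qed.

HB.instance Definition _ :=
  GRing.isZmodule.Build tensor tens_addA tens_addC tens_add0 tens_addN.

Fact tens_scaleDr : right_distributive tens_scale +%R.
Proof.
move=> a x y; rewrite -(treprK x) -(treprK y).
by rewrite -[_ + _]tens_of_cat -!tens_of_scale map_cat tens_of_cat.
Qed.

HB.instance Definition _ := GRing.Zmodule_isLmodule.Build K tensor
  tens_scaleA tens_scale1 tens_scaleDr tens_scaleDl.

Definition pure (v : V) (w : W) : tensor := tens_of [:: (v, w)].

(* Sweedler notation: t = \sum_i v_i (x) w_i for a chosen decomposition, and
   [sweedler t f] is \sum_i f v_i w_i.  It is independent of the decomposition,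
   and linear in t, as soon as f is bilinear (see [sweedler_linear]). *)
Definition sweedler (Z : zmodType) (t : tensor) (f : V -> W -> Z) : Z :=
  \sum_(p <- trepr t) f p.1 p.2.

End TensorDef.

Notation "v \ox w" := (pure v w) : ring_scope.
Notation "\sw_ ( x , y <- t ) E" := (sweedler t (fun x y => E)) : ring_scope.

Section TensorTheory.
Variables (K : fieldType) (V W : lmodType K).
Implicit Types (t : tensor V W) (Z : lmodType K).

Lemma pure_bilin : bilin (@pure K V W).
Proof.
have Dl v v' w : (v + v') \ox w = v \ox w + v' \ox w :> tensor V W.
  by rewrite /pure (tens_of_eq (teq_Dl _ _ _)); apply: (tens_of_cons (v, w)).
have Dr v w w' : v \ox (w + w') = v \ox w + v \ox w' :> tensor V W.
  by rewrite /pure (tens_of_eq (teq_Dr _ _ _)); apply: (tens_of_cons (v, w)).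
have Zl a v w : (a *: v) \ox w = a *: (v \ox w) :> tensor V W.
  by rewrite /pure -[RHS]tens_of_scale.
split=> [w a v v'|v a w w'] /=; first by rewrite Dl Zl.
by rewrite Dr -Zl /pure (tens_of_eq (teq_Z _ _ _)).
Qed.

Lemma tens_of_sum (s : seq (V * W)) : tens_of s = \sum_(p <- s) p.1 \ox p.2.
Proof.
elim: s => [|p s ih]; first by rewrite big_nil.
by rewrite big_cons tens_of_cons ih; case: p.
Qed.

Lemma tensorE t : t = \sw_(v, w <- t) (v \ox w).
Proof. by rewrite /sweedler -tens_of_sum treprK. Qed.

Lemma tensor_ind (P : tensor V W -> Prop) :
  P 0 -> (forall v w t, P t -> P (v \ox w + t)) -> forall t, P t.
Proof.
move=> P0 Pp t; rewrite -(treprK t).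
by elim: (trepr t) => [//|[v w] s ih]; rewrite tens_of_cons; apply: Pp.
Qed.

Section Bilin.
Variables (Z : lmodType K) (f : V -> W -> Z).
Hypothesis fb : bilin f.

Lemma bilinDl v v' w : f (v + v') w = f v w + f v' w.
Proof. by have := fb.1 w 1 v v'; rewrite /= !scale1r. Qed.
Lemma bilinDr v w w' : f v (w + w') = f v w + f v w'.
Proof. by have := fb.2 v 1 w w'; rewrite /= !scale1r. Qed.
Lemma bilin0l w : f 0 w = 0.
Proof. by apply: (addrI (f 0 w)); rewrite -bilinDl !addr0. Qed.
Lemma bilin0r v : f v 0 = 0.
Proof. by apply: (addrI (f v 0)); rewrite -bilinDr !addr0. Qed.
Lemma bilinZl a v w : f (a *: v) w = a *: f v w.
Proof. by have := fb.1 w a v 0; rewrite /= bilin0l !addr0. Qed.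
Lemma bilinZr a v w : f v (a *: w) = a *: f v w.
Proof. by have := fb.2 v a w 0; rewrite /= bilin0r !addr0. Qed.

Lemma sweedler_teq (s t : seq (V * W)) : teq s t ->
  \sum_(p <- s) f p.1 p.2 = \sum_(p <- t) f p.1 p.2.
Proof.
elim=> {s t} [s|s t _ ->|s t u _ -> _ ->|s1 s2 t1 t2 _ h _ h'|s t|w|v v' w|v w w'|b v w] //.
- by rewrite !big_cat /= h h'.
- by rewrite !big_cat /= addrC.
- by rewrite big_seq1 big_nil bilin0l.
- by rewrite big_seq1 !big_cons big_nil addr0 bilinDl.
- by rewrite big_seq1 !big_cons big_nil addr0 bilinDr.
- by rewrite !big_seq1 bilinZl bilinZr.
Qed.

Lemma sweedler_of s : sweedler (tens_of s) f = \sum_(p <- s) f p.1 p.2.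
Proof. exact/sweedler_teq/teq_repr. Qed.

Lemma sweedler_pure v w : sweedler (v \ox w) f = f v w.
Proof. by rewrite sweedler_of big_seq1. Qed.

Lemma sweedler_linear : linear (fun t => sweedler t f).
Proof.
move=> a x y; rewrite -(treprK x) -(treprK y) -[_ *: _]tens_of_scale.
rewrite -[_ + _]tens_of_cat !sweedler_of big_cat big_map scaler_sumr /=.
by congr (_ + _); apply: eq_bigr => p _; rewrite bilinZl.
Qed.

Lemma sweedler0 : sweedler 0 f = 0.
Proof. by rewrite -[0]/(tens_of [::]) sweedler_of big_nil. Qed.
Lemma sweedlerD t t' : sweedler (t + t') f = sweedler t f + sweedler t' f.
Proof. by have := sweedler_linear 1 t t'; rewrite /= !scale1r. Qed.
Lemma sweedlerZ a t : sweedler (a *: t) f = a *: sweedler t f.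
Proof. by have := sweedler_linear a t 0; rewrite /= sweedler0 !addr0. Qed.

End Bilin.

Lemma eq_sweedler (Z : zmodType) t (f h : V -> W -> Z) :
  f =2 h -> sweedler t f = sweedler t h.
Proof. by move=> e; apply: eq_bigr => p _; rewrite e. Qed.

(* no bilinearity needed: both sides use the same decomposition of t *)
Lemma sweedler_add (Z : zmodType) t (f h : V -> W -> Z) :
  \sw_(v, w <- t) (f v w + h v w) = sweedler t f + sweedler t h.
Proof. exact: big_split. Qed.
Lemma sweedler_scale Z a t (f : V -> W -> Z) :
  \sw_(v, w <- t) (a *: f v w) = a *: sweedler t f.
Proof. by rewrite /sweedler scaler_sumr. Qed.
Lemma sweedler_comp Z Z' t (f : V -> W -> Z) (h : Z -> Z') :
  linear h -> h (sweedler t f) = \sw_(v, w <- t) h (f v w).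
Proof.
move=> hl; pose hL : {linear Z -> Z'} :=
  HB.pack h (GRing.isLinear.Build _ _ _ _ h hl).
exact: (linear_sum hL).
Qed.

End TensorTheory.

Section LinearityRules.
Variables (K : fieldType) (X : lmodType K).

Lemma lin_id : linear (fun x : X => x).
Proof. by []. Qed.
Lemma lin_add (Y : lmodType K) (h h' : X -> Y) :
  linear h -> linear h' -> linear (fun x => h x + h' x).
Proof. by move=> hl hl' a x y; rewrite hl hl' scalerDr addrACA. Qed.
Lemma lin_comp (Y Z : lmodType K) (k : Y -> Z) (h : X -> Y) :
  linear k -> linear h -> linear (fun x => k (h x)).
Proof. by move=> kl hl a x y; rewrite hl kl. Qed.
Lemma lin_bilinl (Y Z W : lmodType K) (f : Y -> Z -> W) (h : X -> Y) z :
  bilin f -> linear h -> linear (fun x => f (h x) z).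
Proof. by move=> fb hl a x y; rewrite hl (bilinDl fb) (bilinZl fb). Qed.
Lemma lin_bilinr (Y Z W : lmodType K) (f : Y -> Z -> W) (h : X -> Z) y :
  bilin f -> linear h -> linear (fun x => f y (h x)).
Proof. by move=> fb hl a x z; rewrite hl (bilinDr fb) (bilinZr fb). Qed.
Lemma lin_purel (Y Z : lmodType K) (h : X -> Y) (z : Z) :
  linear h -> linear (fun x => h x \ox z).
Proof. exact/lin_bilinl/pure_bilin. Qed.
Lemma lin_purer (Y Z : lmodType K) (h : X -> Z) (y : Y) :
  linear h -> linear (fun x => y \ox h x).
Proof. exact/lin_bilinr/pure_bilin. Qed.
Lemma lin_mull (A : algType K) (h : X -> A) z :
  linear h -> linear (fun x => h x * z).
Proof. by move=> hl a x y; rewrite hl mulrDl scalerAl. Qed.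
Lemma lin_mulr (A : algType K) (h : X -> A) z :
  linear h -> linear (fun x => z * h x).
Proof. by move=> hl a x y; rewrite hl mulrDr scalerAr. Qed.
Lemma lin_scalel (Y : lmodType K) (h : X -> K) (y : Y) :
  scalar h -> linear (fun x => h x *: y).
Proof. by move=> hl a x z; rewrite hl scalerDl scalerA. Qed.
Lemma lin_scaler (Y : lmodType K) (h : X -> Y) (b : K) :
  linear h -> linear (fun x => b *: h x).
Proof. by move=> hl a x z; rewrite hl scalerDr !scalerA mulrC. Qed.
Lemma lin_sw_body (V W Y : lmodType K) (t : tensor V W) (f : X -> V -> W -> Y) :
  (forall v w, linear (fun x => f x v w)) ->
  linear (fun x => \sw_(v, w <- t) f x v w).
Proof.
move=> fl a x y; rewrite -sweedler_scale -sweedler_add.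
by apply: eq_sweedler => v w; rewrite fl.
Qed.
Lemma lin_sw_arg (V W Y : lmodType K) (h : X -> tensor V W) (f : V -> W -> Y) :
  bilin f -> linear h -> linear (fun x => \sw_(v, w <- h x) f v w).
Proof. by move=> fb hl; apply: lin_comp (sweedler_linear fb) hl. Qed.

End LinearityRules.

Lemma linear_pure (K : fieldType) (V W : lmodType K) (v : V) :
  linear (@pure K V W v).
Proof. exact: (pure_bilin V W).2. Qed.
Lemma linear_mul (K : fieldType) (A : algType K) (a : A) : linear ( *%R a).
Proof. exact/lin_mulr/lin_id. Qed.
Lemma linear_scale (K : fieldType) (V : lmodType K) (a : K) :
  linear ( *:%R a : V -> V).
Proof. exact/lin_scaler/lin_id. Qed.

Record is_alg (K : fieldType) (A : lmodType K) (one : A) (mul : A -> A -> A) : Prop :=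
  IsAlg {
    alg_bilin : bilin mul;
    alg_A : associative mul;
    alg_1l : left_id one mul;
    alg_1r : right_id one mul }.

Definition tmulg (K : fieldType) (A B : lmodType K) (mA : A -> A -> A)
    (mB : B -> B -> B) (s t : tensor A B) : tensor A B :=
  \sw_(a, b <- s) \sw_(a', b' <- t) (mA a a' \ox mB b b').

Definition tmul (K : fieldType) (A B : algType K) (s t : tensor A B) : tensor A B :=
  \sw_(a, b <- s) \sw_(a', b' <- t) ((a * a') \ox (b * b')).

Ltac lin_step :=
  first [ exact: lin_id | assumption
        | exact: linear_pure | exact: linear_mul | exact: linear_scale
        | match goal with |- bilin _ => split => ? /= end
        | match goal with
          | |- GRing.linear_for _ (fun x => @?h x + @?k x) => apply: lin_add
          | |- GRing.linear_for _ (fun x => sweedler _ _) => 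
             first [apply: lin_sw_body => ? ? /= | apply: lin_sw_arg ]
          | |- GRing.linear_for _ (fun x => _ \ox ?k) => apply: lin_purel
          | |- GRing.linear_for _ (fun x => ?k \ox _) => apply: lin_purer
          | |- GRing.linear_for _ (fun x => _ * ?k) => apply: lin_mull
          | |- GRing.linear_for _ (fun x => ?k * _) => apply: lin_mulr
          | |- GRing.linear_for _ (fun x => ?k *: _) => apply: lin_scaler
          | |- GRing.linear_for _ (fun x => _ *: ?k) => apply: lin_scalel
          end ].
Ltac lin := repeat lin_step.

Section TensorAlg.
Variables (K : fieldType) (A B : lmodType K).
Variables (oA : A) (mA : A -> A -> A) (oB : B) (mB : B -> B -> B).
Hypotheses (hA : is_alg oA mA) (hB : is_alg oB mB).

Let bA := alg_bilin hA.
Let bB := alg_bilin hB.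
Let lAl a := bA.1 a.
Let lAr a := bA.2 a.
Let lBl a := bB.1 a.
Let lBr a := bB.2 a.

Lemma tmulg_body s : bilin (fun (a : A) (b : B) =>
  \sw_(a', b' <- s) (mA a a' \ox mB b b')).
Proof.
split=> x; apply: lin_sw_body => ? ?.
  by apply: lin_purel.
by apply: lin_purer.
Qed.

Lemma tmulg_body2 a b : bilin (fun (a' : A) (b' : B) => mA a a' \ox mB b b').
Proof.
split=> x; first exact: (lin_purel _ (lAr a)).
exact: (lin_purer _ (lBr b)).
Qed.

Lemma tmulg_bilin : bilin (tmulg mA mB).
Proof.
split=> x; first exact: (sweedler_linear (tmulg_body x)).
apply: lin_sw_body => a b; exact: (sweedler_linear (tmulg_body2 a b)).
Qed.

Lemma tmulg_pure a b a' b' :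
  tmulg mA mB (a \ox b) (a' \ox b') = mA a a' \ox mB b b'.
Proof.
rewrite /tmulg (sweedler_pure (tmulg_body _)).
exact: (sweedler_pure (tmulg_body2 _ _)).
Qed.

Lemma tmulg_alg : is_alg (oA \ox oB) (tmulg mA mB).
Proof.
have tb := tmulg_bilin.
split=> //.
- move=> x y z.
  elim/tensor_ind: x => [|a b x ihx]; first by rewrite !(bilin0l tb).
  rewrite !(bilinDl tb) {}ihx; congr (_ + _).
  elim/tensor_ind: y => [|a' b' y ihy]; first by rewrite !(bilin0l tb, bilin0r tb, bilin0l tb).
  rewrite !(bilinDl tb, bilinDr tb) {}ihy; congr (_ + _).
  elim/tensor_ind: z => [|a2 b2 z ihz]; first by rewrite !(bilin0r tb).
  by rewrite !(bilinDr tb) ihz !tmulg_pure (alg_A hA) (alg_A hB).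
- elim/tensor_ind => [|a b x ih]; first by rewrite (bilin0r tb).
  by rewrite (bilinDr tb) ih tmulg_pure (alg_1l hA) (alg_1l hB).
- elim/tensor_ind => [|a b x ih]; first by rewrite (bilin0l tb).
  by rewrite (bilinDl tb) ih tmulg_pure (alg_1r hA) (alg_1r hB).
Qed.

End TensorAlg.

Lemma algType_is_alg (K : fieldType) (A : algType K) : is_alg (1 : A) *%R.
Proof.
split; [|exact: mulrA|exact: mul1r|exact: mulr1].
by split=> x; [apply: lin_mull|apply: lin_mulr].
Qed.

Lemma tmul_alg (K : fieldType) (A B : algType K) :
  is_alg (1 \ox 1) (@tmul K A B).
Proof. exact: (tmulg_alg (algType_is_alg A) (algType_is_alg B)). Qed.

Lemma tmul_pure (K : fieldType) (A B : algType K) (a a' : A) (b b' : B) :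
  tmul (a \ox b) (a' \ox b') = (a * a') \ox (b * b').
Proof. exact: (tmulg_pure (algType_is_alg A) (algType_is_alg B)). Qed.

HB.mixin Record Algebra_isHopf (K : fieldType) A of GRing.Algebra K A := {
  comult : A -> tensor A A;
  counit : A -> K;
  antipode : A -> A;
  comult_linear : linear comult;
  counit_linear : scalar counit;
  antipode_linear : linear antipode;
  comultA : forall a,
    \sw_(a1, a2 <- comult a) \sw_(a11, a12 <- comult a1) (a11 \ox a12 \ox a2) =
    \sw_(a1, a2 <- comult a) \sw_(a21, a22 <- comult a2) (a1 \ox a21 \ox a22);
  counitl : forall a, \sw_(a1, a2 <- comult a) (counit a1 *: a2) = a;
  counitr : forall a, \sw_(a1, a2 <- comult a) (counit a2 *: a1) = a;
  comult1 : comult 1 = 1 \ox 1;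
  comultM : forall a b, comult (a * b) = tmul (comult a) (comult b);
  counit1 : counit 1 = 1;
  counitM : forall a b, counit (a * b) = counit a * counit b;
  antipodel : forall a, \sw_(a1, a2 <- comult a) (antipode a1 * a2) = (counit a)%:A;
  antipoder : forall a, \sw_(a1, a2 <- comult a) (a1 * antipode a2) = (counit a)%:A
}.

#[short(type="hopfAlgType")]
HB.structure Definition HopfAlgebra (K : fieldType) :=
  {A of GRing.Algebra K A & Algebra_isHopf K A}.

#[short(type="comHopfAlgType")]
HB.structure Definition ComHopfAlgebra (K : fieldType) :=
  {A of GRing.ComAlgebra K A & Algebra_isHopf K A}.

HB.mixin Record Lmodule_isLie (K : fieldType) g of GRing.Lmodule K g := {
  bracket : g -> g -> g;
  bracket_linl : forall z, linear (bracket^~ z);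
  bracket_linr : forall z, linear (bracket z);
  bracketxx : forall x, bracket x x = 0;
  jacobi : forall x y z,
    bracket x (bracket y z) + bracket y (bracket z x) + bracket z (bracket x y) = 0
}.

#[short(type="lieAlgType")]
HB.structure Definition LieAlgebra (K : fieldType) :=
  {g of GRing.Lmodule K g & Lmodule_isLie K g}.

(* [Vector] means finite dimensional *)
#[short(type="finLieAlgType")]
HB.structure Definition FinLieAlgebra (K : fieldType) :=
  {g of Vector K g & Lmodule_isLie K g}.

Section Envelope.
Variables (K : fieldType) (g : lieAlgType K).

(* U(g) is the unital associative algebra presented by the generators [UGen x],
   x in g, the linear relations of g and xy - yx = [x, y].  [UScal a] is the
   scalar a seen in the algebra. *)
Inductive uterm : Type :=
| UGen of g
| UScal of K
| UAdd of uterm & uterm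
| UMul of uterm & uterm.

HB.instance Definition _ := gen_eqMixin uterm.
HB.instance Definition _ := gen_choiceMixin uterm.

Inductive ueq : uterm -> uterm -> Prop :=
| ueq_refl s : ueq s s
| ueq_sym s t : ueq s t -> ueq t s
| ueq_trans s t u : ueq s t -> ueq t u -> ueq s u
| ueq_add s s' t t' : ueq s s' -> ueq t t' -> ueq (UAdd s t) (UAdd s' t')
| ueq_mul s s' t t' : ueq s s' -> ueq t t' -> ueq (UMul s t) (UMul s' t')
| ueq_addA s t u : ueq (UAdd s (UAdd t u)) (UAdd (UAdd s t) u)
| ueq_addC s t : ueq (UAdd s t) (UAdd t s)
| ueq_add0 s : ueq (UAdd (UScal 0) s) s
| ueq_addN s : ueq (UAdd (UMul (UScal (-1)) s) s) (UScal 0)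
| ueq_mulA s t u : ueq (UMul s (UMul t u)) (UMul (UMul s t) u)
| ueq_mul1 s : ueq (UMul (UScal 1) s) s
| ueq_mulDl s t u : ueq (UMul (UAdd s t) u) (UAdd (UMul s u) (UMul t u))
| ueq_mulDr s t u : ueq (UMul s (UAdd t u)) (UAdd (UMul s t) (UMul s u))
| ueq_scalC a s : ueq (UMul (UScal a) s) (UMul s (UScal a))
| ueq_scalD a b : ueq (UScal (a + b)) (UAdd (UScal a) (UScal b))
| ueq_scalM a b : ueq (UScal (a * b)) (UMul (UScal a) (UScal b))
| ueq_genD x y : ueq (UGen (x + y)) (UAdd (UGen x) (UGen y))
| ueq_genZ a x : ueq (UGen (a *: x)) (UMul (UScal a) (UGen x))
| ueq_lie x y : ueq (UAdd (UGen (bracket x y)) (UMul (UGen y) (UGen x)))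
                    (UMul (UGen x) (UGen y)).

Definition ueqb : rel uterm := fun s t => `[< ueq s t >].

Fact ueqb_refl : reflexive ueqb.
Proof. by move=> s; apply/asboolP; apply: ueq_refl. Qed.
Fact ueqb_sym : symmetric ueqb.
Proof. by move=> s t; apply/asboolP/asboolP; apply: ueq_sym. Qed.
Fact ueqb_trans : transitive ueqb.
Proof. by move=> t s u /asboolP h /asboolP h'; apply/asboolP; apply: ueq_trans h h'. Qed.

Canonical ueq_equiv := EquivRel ueqb ueqb_refl ueqb_sym ueqb_trans.

Definition envelope := {eq_quot ueq_equiv}%qT.
HB.instance Definition _ := Choice.on envelope.

Definition env_of (s : uterm) : envelope := \pi_{eq_quot ueq_equiv}%qT s.
Definition urepr (u : envelope) : uterm := repr u.

Lemma env_of_eq s t : ueq s t -> env_of s = env_of t.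
Proof. by move=> h; apply/eqmodP/asboolP. Qed.

Lemma ueq_repr s : ueq (urepr (env_of s)) s.
Proof. by have /eqmodP/asboolP := reprK (\pi_{eq_quot ueq_equiv}%qT s). Qed.

Lemma ureprK u : env_of (urepr u) = u.
Proof. exact: reprK. Qed.

Definition env_scal a := env_of (UScal a).
Definition env_add u v := env_of (UAdd (urepr u) (urepr v)).
Definition env_mul u v := env_of (UMul (urepr u) (urepr v)).
Definition env_opp u := env_mul (env_scal (-1)) u.

Lemma env_ofD s t : env_of (UAdd s t) = env_add (env_of s) (env_of t).
Proof. by apply/env_of_eq/ueq_sym/ueq_add; apply: ueq_repr. Qed.
Lemma env_ofM s t : env_of (UMul s t) = env_mul (env_of s) (env_of t).
Proof. by apply/env_of_eq/ueq_sym/ueq_mul; apply: ueq_repr. Qed.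

Fact env_addA : associative env_add.
Proof.
move=> u v w; rewrite -(ureprK u) -(ureprK v) -(ureprK w) -!env_ofD.
exact/env_of_eq/ueq_addA.
Qed.
Fact env_addC : commutative env_add.
Proof. by move=> u v; apply/env_of_eq/ueq_addC. Qed.
Fact env_add0 : left_id (env_scal 0) env_add.
Proof. by move=> u; rewrite /env_scal -(ureprK u) -env_ofD; apply/env_of_eq/ueq_add0. Qed.
Fact env_addN : left_inverse (env_scal 0) env_opp env_add.
Proof.
by move=> u; rewrite /env_opp -(ureprK u) -env_ofM -env_ofD; apply/env_of_eq/ueq_addN.
Qed.

HB.instance Definition _ :=
  GRing.isZmodule.Build envelope env_addA env_addC env_add0 env_addN.

Fact env_mulA : associative env_mul.
Proof.
move=> u v w; rewrite -(ureprK u) -(ureprK v) -(ureprK w) -!env_ofM.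
exact/env_of_eq/ueq_mulA.
Qed.
Fact env_mul1l : left_id (env_scal 1) env_mul.
Proof. by move=> u; rewrite /env_scal -(ureprK u) -env_ofM; apply/env_of_eq/ueq_mul1. Qed.
Fact env_scalC a u : env_mul (env_scal a) u = env_mul u (env_scal a).
Proof. by rewrite /env_scal -(ureprK u) -!env_ofM; apply/env_of_eq/ueq_scalC. Qed.
Fact env_mul1r : right_id (env_scal 1) env_mul.
Proof. by move=> u; rewrite -env_scalC env_mul1l. Qed.
Fact env_mulDl : left_distributive env_mul +%R.
Proof.
move=> u v w; rewrite -(ureprK u) -(ureprK v) -(ureprK w).
by rewrite -[_ + _]env_ofD -!env_ofM -[RHS]env_ofD; apply/env_of_eq/ueq_mulDl.
Qed.
Fact env_mulDr : right_distributive env_mul +%R.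
Proof.
move=> u v w; rewrite -(ureprK u) -(ureprK v) -(ureprK w).
by rewrite -[_ + _]env_ofD -!env_ofM -[RHS]env_ofD; apply/env_of_eq/ueq_mulDr.
Qed.

Fixpoint uaug (t : uterm) : K :=
  match t with
  | UGen _ => 0
  | UScal a => a
  | UAdd s t => uaug s + uaug t
  | UMul s t => uaug s * uaug t
  end.

Lemma uaug_ueq s t : ueq s t -> uaug s = uaug t.
Proof.
elim=> {s t} //=; intros; rewrite ?(addrA, addr0, add0r, mulrA, mul1r, mulr0, mulrDl, mulrDr) //;
  try congruence; try exact: addrC; try exact: mulrC.
by rewrite mulN1r addNr.
Qed.

Fact env_1neq0 : env_scal 1 != env_scal 0.
Proof.
apply/eqP => /eqmodP/asboolP/uaug_ueq /= /eqP; exact/negP/oner_neq0.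
Qed.

HB.instance Definition _ := GRing.Zmodule_isNzRing.Build envelope
  env_mulA env_mul1l env_mul1r env_mulDl env_mulDr env_1neq0.

Definition env_scale a u := env_mul (env_scal a) u.

Fact env_scaleA a b u : env_scale a (env_scale b u) = env_scale (a * b) u.
Proof.
rewrite /env_scale env_mulA; congr env_mul; rewrite -env_ofM.
exact/env_of_eq/ueq_sym/ueq_scalM.
Qed.
Fact env_scale1 : left_id 1 env_scale.
Proof. exact: env_mul1l. Qed.
Fact env_scaleDr : right_distributive env_scale +%R.
Proof. by move=> a; apply: env_mulDr. Qed.
Fact env_scaleDl u : {morph env_scale^~ u : a b / a + b}.
Proof.
move=> a b; rewrite -[RHS]env_mulDl; congr env_mul.
by rewrite -[RHS]env_ofD; apply/env_of_eq/ueq_scalD.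
Qed.

HB.instance Definition _ := GRing.Zmodule_isLmodule.Build K envelope
  env_scaleA env_scale1 env_scaleDr env_scaleDl.

Fact env_scaleAl a (u v : envelope) : a *: (u * v) = (a *: u) * v.
Proof. exact: env_mulA. Qed.
HB.instance Definition _ := GRing.Lmodule_isLalgebra.Build K envelope env_scaleAl.
Fact env_scaleAr a (u v : envelope) : a *: (u * v) = u * (a *: v).
Proof.
rewrite -[LHS]/(env_mul (env_scal a) (env_mul u v)).
by rewrite -[RHS]/(env_mul u (env_mul (env_scal a) v)) !env_mulA env_scalC.
Qed.
HB.instance Definition _ := GRing.Lalgebra_isAlgebra.Build K envelope env_scaleAr.

Lemma env_scalE a : env_scal a = a%:A.
Proof. exact: esym (env_mul1r _). Qed.

Definition env_gen (x : g) : envelope := env_of (UGen x).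

Lemma env_gen_linear : linear env_gen.
Proof.
move=> a x y; rewrite /env_gen (env_of_eq (ueq_genD _ _)) env_ofD.
by rewrite (env_of_eq (ueq_genZ _ _)) env_ofM.
Qed.
HB.instance Definition _ := GRing.isLinear.Build _ _ _ _ env_gen env_gen_linear.

Lemma env_gen_bracket x y :
  env_gen (bracket x y) = env_gen x * env_gen y - env_gen y * env_gen x.
Proof.
apply/eqP; rewrite eq_sym subr_eq; apply/eqP.
rewrite -[LHS]/(env_mul (env_of (UGen x)) (env_of (UGen y))).
rewrite -[RHS]/(env_add (env_of _) (env_mul (env_of (UGen y)) (env_of (UGen x)))).
by rewrite -!env_ofM -env_ofD; apply/env_of_eq/ueq_sym/ueq_lie.
Qed.

Lemma envelope_ind (P : envelope -> Prop) :
  (forall x, P (env_gen x)) -> P 1 ->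
  (forall a u v, P u -> P v -> P (a *: u + v)) ->
  (forall u v, P u -> P v -> P (u * v)) -> forall u, P u.
Proof.
move=> Pg P1 PD PM u; rewrite -(ureprK u).
have P0 : P 0 by rewrite -(addNr 1) -scaleN1r; apply: PD.
elim: (urepr u) => [x|a|s ihs t iht|s ihs t iht].
- exact: Pg.
- by rewrite -/(env_scal a) env_scalE -[_ *: _]addr0; apply: PD.
- by rewrite env_ofD -[env_of s]scale1r; apply: PD.
- by rewrite env_ofM; apply: PM.
Qed.

Section Lift.
Variables (A : lmodType K) (one : A) (mul : A -> A -> A) (phi : g -> A).
Hypothesis hA : is_alg one mul.
Hypothesis phi_linear : linear phi.
Hypothesis phi_bracket : forall x y,
  phi (bracket x y) = mul (phi x) (phi y) - mul (phi y) (phi x).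

Fixpoint ueval (t : uterm) : A :=
  match t with
  | UGen x => phi x
  | UScal a => a *: one
  | UAdd s t => ueval s + ueval t
  | UMul s t => mul (ueval s) (ueval t)
  end.

Definition env_lift (u : envelope) : A := ueval (urepr u).

Let mb := alg_bilin hA.

Lemma ueval_ueq s t : ueq s t -> ueval s = ueval t.
Proof.
have phi0 : phi 0 = 0.
  have := phi_linear 1 0 0; rewrite !scale1r addr0 => h.
  by apply: (addrI (phi 0)); rewrite -h addr0.
elim=> {s t} /=.
- by [].
- by move=> s t _ ->.
- by move=> s t u _ -> _ ->.
- by move=> s s' t t' _ -> _ ->.
- by move=> s s' t t' _ -> _ ->.
- by move=> s t u; rewrite addrA.
- by move=> s t; rewrite addrC.
- by move=> s; rewrite scale0r add0r.
- by move=> s; rewrite (bilinZl mb) (alg_1l hA) scaleN1r addNr scale0r.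
- by move=> s t u; rewrite (alg_A hA).
- by move=> s; rewrite scale1r (alg_1l hA).
- by move=> s t u; rewrite (bilinDl mb).
- by move=> s t u; rewrite (bilinDr mb).
- by move=> a s; rewrite (bilinZl mb) (bilinZr mb) (alg_1l hA) (alg_1r hA).
- by move=> a b; rewrite scalerDl.
- by move=> a b; rewrite (bilinZl mb) (alg_1l hA) scalerA.
- by move=> x y; have := phi_linear 1 x y; rewrite !scale1r.
- move=> a x; have := phi_linear a x 0; rewrite phi0 !addr0 => ->.
  by rewrite (bilinZl mb) (alg_1l hA).
- by move=> x y; rewrite phi_bracket addrNK.
Qed.

Lemma env_lift_of s : env_lift (env_of s) = ueval s.
Proof. exact/ueval_ueq/ueq_repr. Qed.

Lemma env_lift_gen x : env_lift (env_gen x) = phi x.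
Proof. exact: env_lift_of. Qed.
Lemma env_liftM u v : env_lift (u * v) = mul (env_lift u) (env_lift v).
Proof. by rewrite -(ureprK u) -(ureprK v) -[_ * _]env_ofM !env_lift_of. Qed.
Lemma env_lift_linear : linear env_lift.
Proof.
move=> a u v; rewrite -(ureprK u) -(ureprK v).
rewrite -[_ *: _]env_ofM -[_ + _]env_ofD !env_lift_of /=.
by rewrite (bilinZl mb) (alg_1l hA).
Qed.
Lemma env_lift1 : env_lift 1 = one.
Proof. by rewrite -[LHS]/(env_lift (env_of (UScal 1))) env_lift_of /= scale1r. Qed.

End Lift.

Lemma env_hom_unique (A : lmodType K) (mul : A -> A -> A) (h k : envelope -> A) :
  linear h -> linear k -> h 1 = k 1 ->
  {morph h : u v / u * v >-> mul u v} -> {morph k : u v / u * v >-> mul u v} ->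
  (forall x, h (env_gen x) = k (env_gen x)) -> h =1 k.
Proof.
move=> hl kl h1 hM kM e; apply: envelope_ind => //.
- by move=> a u v eu ev; rewrite hl kl eu ev.
- by move=> u v eu ev; rewrite hM kM eu ev.
Qed.

End Envelope.

Lemma sweedler_tmul (K : fieldType) (A B : algType K) (Z : lmodType K)
    (k : A -> B -> Z) (s t : tensor A B) : bilin k ->
  sweedler (tmul s t) k =
  \sw_(a, b <- s) \sw_(a', b' <- t) k (a * a') (b * b').
Proof.
move=> kb; rewrite /tmul (sweedler_comp _ _ (sweedler_linear kb)).
apply: eq_sweedler => a b; rewrite (sweedler_comp _ _ (sweedler_linear kb)).
by apply: eq_sweedler => a' b'; rewrite (sweedler_pure kb).
Qed.

Lemma sweedler_tmulM (K : fieldType) (A B : algType K) (Z : lmodType K)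
    (mul : Z -> Z -> Z) (k0 k k' : A -> B -> Z) (s t : tensor A B) :
  bilin mul -> bilin k0 ->
  (forall a b a' b', k0 (a * a') (b * b') = mul (k a b) (k' a' b')) ->
  sweedler (tmul s t) k0 = mul (sweedler s k) (sweedler t k').
Proof.
move=> mb kb h; rewrite (sweedler_tmul _ _ kb).
rewrite (sweedler_comp s k (mb.1 _)); apply: eq_sweedler => a b.
rewrite (sweedler_comp t k' (mb.2 _)); apply: eq_sweedler => a' b'.
exact: h.
Qed.

Fact primitive_bracket_subproof (M : zmodType) (a b c d p q : M) :
  a + p + (q + c) - (b + q + (p + d)) = a - b + (c - d).
Proof.
rewrite (addrC q c) (addrC p d) (addrACA a) (addrACA b) (addrC q p).
by rewrite opprD [LHS]addrACA subrr addr0 opprD addrACA.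
Qed.

Section EnvelopeHopf.
Variables (K : fieldType) (g : lieAlgType K).
Local Notation U := (GRing.Algebra.clone K (envelope g) _).
Local Notation i := (@env_gen K g).

Let mulU : is_alg (1 : U) *%R := algType_is_alg U.
Let mulT : is_alg (1 \ox 1) (@tmul K U U) := tmul_alg U U.
Let il : linear i := @env_gen_linear K g.

Definition env_primitive (x : g) : tensor U U := i x \ox 1 + 1 \ox i x.

Fact env_primitive_linear : linear env_primitive.
Proof. by apply: lin_add; [apply: lin_purel|apply: lin_purer]. Qed.

Fact env_primitive_bracket x y : env_primitive (bracket x y) =
  tmul (env_primitive x) (env_primitive y) - tmul (env_primitive y) (env_primitive x).
Proof.
have tb := alg_bilin mulT; have pb := @pure_bilin K U U.
rewrite /env_primitive !(bilinDl tb, bilinDr tb) !tmul_pure !(mul1r, mulr1).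
rewrite env_gen_bracket -!scaleN1r !(bilinDl pb, bilinDr pb, bilinZl pb, bilinZr pb).
rewrite !scaleN1r; symmetry; exact: primitive_bracket_subproof.
Qed.

Definition env_comult : U -> tensor U U := env_lift (1 \ox 1) (@tmul K U U) env_primitive.

Fact env_comult_linear : linear env_comult.
Proof. exact: env_lift_linear mulT env_primitive_linear env_primitive_bracket. Qed.
Fact env_comult1 : env_comult 1 = 1 \ox 1.
Proof. exact: env_lift1 mulT env_primitive_linear env_primitive_bracket. Qed.
Fact env_comultM u v : env_comult (u * v) = tmul (env_comult u) (env_comult v).
Proof. exact: env_liftM mulT env_primitive_linear env_primitive_bracket _ _. Qed.
Fact env_comult_gen x : env_comult (i x) = i x \ox 1 + 1 \ox i x.
Proof. exact: env_lift_gen mulT env_primitive_linear env_primitive_bracket x. Qed.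

Let Ko_alg : is_alg (1 : K^o) *%R := algType_is_alg K^o.
Let zero_linear : linear (fun _ : g => 0 : K^o).
Proof. by move=> a x y; rewrite scaler0 addr0. Qed.
Let zero_bracket (x y : g) : 0 = 0 * 0 - 0 * 0 :> K^o.
Proof. by rewrite mulr0 subrr. Qed.

Definition env_counit : U -> K := env_lift (1 : K^o) *%R (fun _ => 0).

Fact env_counit_linear : scalar env_counit.
Proof. exact: env_lift_linear Ko_alg zero_linear zero_bracket. Qed.
Fact env_counit1 : env_counit 1 = 1.
Proof. exact: env_lift1 Ko_alg zero_linear zero_bracket. Qed.
Fact env_counitM u v : env_counit (u * v) = env_counit u * env_counit v.
Proof. exact: env_liftM Ko_alg zero_linear zero_bracket _ _. Qed.
Fact env_counit_gen x : env_counit (i x) = 0.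
Proof. exact: env_lift_gen Ko_alg zero_linear zero_bracket x. Qed.

Let mulop := fun u v : U => v * u.
Let mulop_alg : is_alg (1 : U) mulop.
Proof.
rewrite /mulop; split; [|by move=> ? ? ?; rewrite mulrA|exact: mulr1|exact: mul1r].
by split=> x; [apply: lin_mulr|apply: lin_mull].
Qed.
Let opp_linear : linear (fun x => - i x).
Proof. by move=> a x y; rewrite il opprD scalerN. Qed.
Let opp_bracket x y : - i (bracket x y) = mulop (- i x) (- i y) - mulop (- i y) (- i x).
Proof. by rewrite /mulop !mulrNN env_gen_bracket opprB. Qed.

Definition env_antipode : U -> U := env_lift 1 (fun u v => v * u) (fun x => - i x).

Fact env_antipode_linear : linear env_antipode.
Proof. exact: env_lift_linear mulop_alg opp_linear opp_bracket. Qed.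
Fact env_antipode1 : env_antipode 1 = 1.
Proof. exact: env_lift1 mulop_alg opp_linear opp_bracket. Qed.
Fact env_antipodeM u v : env_antipode (u * v) = env_antipode v * env_antipode u.
Proof. exact: env_liftM mulop_alg opp_linear opp_bracket _ _. Qed.
Fact env_antipode_gen x : env_antipode (i x) = - i x.
Proof. exact: env_lift_gen mulop_alg opp_linear opp_bracket x. Qed.

Let cl := env_comult_linear.
Let el := env_counit_linear.
Let sl := env_antipode_linear.
Let pb := @pure_bilin K.

Let tripl : bilin (fun a1 a2 : U =>
  \sw_(a11, a12 <- env_comult a1) (a11 \ox a12 \ox a2)).
Proof.
split=> z; first by apply: lin_sw_arg => //; lin.
by lin.
Qed.
Let tripr : bilin (fun a1 a2 : U =>
  \sw_(a21, a22 <- env_comult a2) (a1 \ox a21 \ox a22)).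
Proof.
split=> z; first by lin.
by apply: lin_sw_arg => //; lin.
Qed.

Let mul3 : is_alg (1 \ox 1 \ox 1) (tmulg (@tmul K U U) (@GRing.mul U)) :=
  tmulg_alg mulT mulU.
Let mul3_pure a b c a' b' c' :
  tmulg (@tmul K U U) (@GRing.mul U) (a \ox b \ox c) (a' \ox b' \ox c') =
  (a * a') \ox (b * b') \ox (c * c').
Proof. by rewrite (tmulg_pure mulT mulU) tmul_pure. Qed.

Fact env_comultA u :
  \sw_(a1, a2 <- env_comult u) \sw_(a11, a12 <- env_comult a1) (a11 \ox a12 \ox a2) =
  \sw_(a1, a2 <- env_comult u) \sw_(a21, a22 <- env_comult a2) (a1 \ox a21 \ox a22).
Proof.
have b1 (c : U) : bilin (fun a b : U => a \ox b \ox c) by lin.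
have b2 (c : U) : bilin (fun a b : U => c \ox a \ox b) by lin.
move: u; apply: (env_hom_unique (mul := tmulg (@tmul K U U) (@GRing.mul U))).
- by apply: lin_sw_arg.
- by apply: lin_sw_arg.
- by rewrite !env_comult1 (sweedler_pure tripl) (sweedler_pure tripr)
    !env_comult1 (sweedler_pure (b1 1)) (sweedler_pure (b2 1)).
- move=> u v; rewrite env_comultM; apply: sweedler_tmulM => //.
    exact: alg_bilin mul3.
  move=> a b a' b'; rewrite env_comultM; apply: sweedler_tmulM => //.
    exact: alg_bilin mul3.
- move=> u v; rewrite env_comultM; apply: sweedler_tmulM => //.
    exact: alg_bilin mul3.
  move=> a b a' b'; rewrite env_comultM; apply: sweedler_tmulM => //.
    exact: alg_bilin mul3.
- move=> x; rewrite env_comult_gen (sweedlerD tripl) (sweedlerD tripr).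
  rewrite !(sweedler_pure tripl) !(sweedler_pure tripr) env_comult_gen env_comult1.
  rewrite !(sweedlerD (b1 _)) !(sweedlerD (b2 _)).
  by rewrite !(sweedler_pure (b1 _)) !(sweedler_pure (b2 _)) addrA.
Qed.

Let cnl : bilin (fun a b : U => env_counit a *: b). Proof. by lin. Qed.
Let cnr : bilin (fun a b : U => env_counit b *: a). Proof. by lin. Qed.

Fact env_counitl u : \sw_(a1, a2 <- env_comult u) (env_counit a1 *: a2) = u.
Proof.
move: u; apply: (env_hom_unique (mul := @GRing.mul U)) => //.
- by apply: lin_sw_arg.
- by rewrite env_comult1 (sweedler_pure cnl) env_counit1 scale1r.
- move=> u v; rewrite env_comultM; apply: sweedler_tmulM => //.
    exact: alg_bilin mulU.
  by move=> a b a' b'; rewrite env_counitM -scalerAl -scalerAr scalerA.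
- move=> x; rewrite env_comult_gen (sweedlerD cnl) !(sweedler_pure cnl).
  by rewrite env_counit_gen env_counit1 scale0r add0r scale1r.
Qed.

Fact env_counitr u : \sw_(a1, a2 <- env_comult u) (env_counit a2 *: a1) = u.
Proof.
move: u; apply: (env_hom_unique (mul := @GRing.mul U)) => //.
- by apply: lin_sw_arg.
- by rewrite env_comult1 (sweedler_pure cnr) env_counit1 scale1r.
- move=> u v; rewrite env_comultM; apply: sweedler_tmulM => //.
    exact: alg_bilin mulU.
  by move=> a b a' b'; rewrite env_counitM -scalerAl -scalerAr scalerA.
- move=> x; rewrite env_comult_gen (sweedlerD cnr) !(sweedler_pure cnr).
  by rewrite env_counit_gen env_counit1 scale0r addr0 scale1r.
Qed.

Let anl : bilin (fun a b : U => env_antipode a * b). Proof. by lin. Qed.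
Let anr : bilin (fun a b : U => a * env_antipode b). Proof. by lin. Qed.

Fact env_antipodel u :
  \sw_(a1, a2 <- env_comult u) (env_antipode a1 * a2) = (env_counit u)%:A.
Proof.
elim/envelope_ind: u => [x||a u v ihu ihv|u v ihu ihv].
- rewrite env_comult_gen (sweedlerD anl) !(sweedler_pure anl).
  by rewrite env_antipode1 env_antipode_gen env_counit_gen mulr1 mul1r addNr scale0r.
- by rewrite env_comult1 (sweedler_pure anl) env_antipode1 env_counit1 mulr1 scale1r.
- by rewrite cl (sweedlerD anl) (sweedlerZ anl) ihu ihv el scalerDl scalerA.
- rewrite env_comultM (sweedler_tmul _ _ anl).
  pose G w := \sw_(a, b <- env_comult v) (env_antipode a * w * b).
  have Gl : linear G by apply: lin_sw_body => ? ?; lin.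
  transitivity (G (\sw_(a, b <- env_comult u) (env_antipode a * b))).
    rewrite (sweedler_comp _ _ Gl); apply: eq_sweedler => a b.
    by apply: eq_sweedler => a' b'; rewrite env_antipodeM !mulrA.
  rewrite ihu /G env_counitM -scalerA -ihv -sweedler_scale.
  by apply: eq_sweedler => a b; rewrite -scalerAr mulr1 scalerAl.
Qed.

Fact env_antipoder u :
  \sw_(a1, a2 <- env_comult u) (a1 * env_antipode a2) = (env_counit u)%:A.
Proof.
elim/envelope_ind: u => [x||a u v ihu ihv|u v ihu ihv].
- rewrite env_comult_gen (sweedlerD anr) !(sweedler_pure anr).
  by rewrite env_antipode1 env_antipode_gen env_counit_gen mulr1 mul1r addrN scale0r.
- by rewrite env_comult1 (sweedler_pure anr) env_antipode1 env_counit1 mulr1 scale1r.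
- by rewrite cl (sweedlerD anr) (sweedlerZ anr) ihu ihv el scalerDl scalerA.
- rewrite env_comultM (sweedler_tmul _ _ anr) env_counitM mulrC -scalerA -ihu.
  rewrite -sweedler_scale; apply: eq_sweedler => a b.
  pose G w := a * w * env_antipode b.
  have Gl : linear G by rewrite /G; lin.
  transitivity (G (\sw_(a, b <- env_comult v) (a * env_antipode b))).
    rewrite (sweedler_comp _ _ Gl); apply: eq_sweedler => a' b'.
    by rewrite /G env_antipodeM !mulrA.
  by rewrite ihv /G -scalerAr mulr1 scalerAl.
Qed.

HB.instance Definition _ := Algebra_isHopf.Build K (envelope g)
  env_comult_linear env_counit_linear env_antipode_linear
  env_comultA env_counitl env_counitr env_comult1 env_comultM
  env_counit1 env_counitM env_antipodel env_antipoder.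

End EnvelopeHopf.

Definition Ug (K : fieldType) (g : lieAlgType K) : hopfAlgType K :=
  HopfAlgebra.clone K (envelope g) _.

Lemma Ug_comult_gen (K : fieldType) (g : lieAlgType K) (x : g) :
  comult (env_gen x : Ug g) = (env_gen x : Ug g) \ox 1 + 1 \ox (env_gen x : Ug g).
Proof. exact: env_comult_gen. Qed.
Lemma Ug_counit_gen (K : fieldType) (g : lieAlgType K) (x : g) :
  counit (env_gen x : Ug g) = 0.
Proof. exact: env_counit_gen. Qed.

Record right_coaction (K : fieldType) (F : hopfAlgType K) (V : lmodType K)
    (rho : V -> tensor V F) : Prop := RightCoaction {
  coact_linear : linear rho;
  coactA : forall v,
    \sw_(v0, v1 <- rho v) \sw_(v00, v01 <- rho v0) (v00 \ox v01 \ox v1) =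
    \sw_(v0, v1 <- rho v) \sw_(f1, f2 <- comult v1) (v0 \ox f1 \ox f2);
  coact_counit : forall v, \sw_(v0, v1 <- rho v) (counit v1 *: v0) = v
}.

Record derivation_action (K : fieldType) (g : lieAlgType K) (F : algType K)
    (act : g -> F -> F) : Prop := DerivationAction {
  lact_bilin : bilin act;
  lact_bracket : forall X Y f, act (bracket X Y) f = act X (act Y f) - act Y (act X f);
  lact_der : forall X f h, act X (f * h) = act X f * h + f * act X h
}.

(* In a basis X_1, ..., X_n of g, with [X_i, X_j] = \sum_k C^k_ij X_k and
   rho X_j = \sum_i X_i (x) f^i_j: here f i j is f^i_j, and C^k_ij is
   coord X k [X_i, X_j].  The identity does not depend on the basis, and the
   f^i_j exist by [coaction_coefP]. *)
Definition structure_identity (K : fieldType) (g : finLieAlgType K)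
    (F : comHopfAlgType K) (act : g -> F -> F) (rho : g -> tensor g F) : Prop :=
  forall (n : nat) (X : n.-tuple g) (f : 'I_n -> 'I_n -> F),
    basis_of fullv X ->
    (forall j : 'I_n, rho X`_j = \sum_(i < n) (X`_i \ox f i j)) ->
    forall i j k : 'I_n,
      act X`_i (f k j) - act X`_j (f k i) =
      \sum_(s < n) \sum_(r < n) coord X k (bracket X`_s X`_r) *: (f r i * f s j)
      + \sum_(l < n) coord X l (bracket X`_i X`_j) *: f k l.

Lemma coaction_coefP (K : fieldType) (g : vectType K) (F : lmodType K)
    (n : nat) (X : n.-tuple g) (t : tensor g F) :
  basis_of fullv X ->
  t = \sum_(i < n) (X`_i \ox \sw_(v, c <- t) (coord X i v *: c)).
Proof.
move=> bX.
have cb i : bilin (fun (v : g) (c : F) => coord X i v *: c).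
  split=> z; last exact: linear_scale.
  by apply: lin_scalel => a x y; rewrite linearP.
elim/tensor_ind: t => [|v w t {1}->].
  by rewrite big1 // => i _; rewrite (sweedler0 (cb i)) (bilin0r (pure_bilin g F)).
under [RHS]eq_bigr => i _ do
  rewrite (sweedlerD (cb i)) (bilinDr (pure_bilin g F)) (sweedler_pure (cb i)).
rewrite big_split /=; congr (_ + _).
rewrite {1}(coord_basis bX (memvf v)).
pose h x : tensor g F := x \ox w.
have hl : linear h := (pure_bilin g F).1 w.
pose hL : {linear g -> tensor g F} := HB.pack h (GRing.isLinear.Build _ _ _ _ h hl).
rewrite -[LHS]/(hL _) linear_sum; apply: eq_bigr => i _.
by rewrite linearZ (bilinZr (pure_bilin g F)).
Qed.

Record g_Hopf (K : fieldType) (g : finLieAlgType K) (F : comHopfAlgType K)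
    (act : g -> F -> F) (rho : g -> tensor g F) : Prop := GHopf {
  gH_act : derivation_action act;
  gH_coact : right_coaction rho;
  gH_structure : structure_identity act rho;
  gH_counit : forall X f, counit (act X f) = 0;
  gH_comult : forall X f,
    comult (act X f) =
    \sw_(f1, f2 <- comult f)
      (\sw_(X0, X1 <- rho X) (act X0 f1 \ox (X1 * f2)) + f1 \ox act X f2)
}.

Record left_module (K : fieldType) (U : algType K) (M : lmodType K)
    (act : U -> M -> M) : Prop := LeftModule {
  act_bilin : bilin act;
  act_1 : forall m, act 1 m = m;
  act_M : forall u v m, act (u * v) m = act u (act v m)
}.

Definition coact_mul (K : fieldType) (U F : hopfAlgType K)
    (act : U -> F -> F) (rho : U -> tensor U F) : Prop :=
  forall u v, rho (u * v) =
    \sw_(u1, u2 <- comult u) \sw_(u10, u11 <- rho u1) \sw_(v0, v1 <- rho v)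
      ((u10 * v0) \ox (u11 * act u2 v1)).

Record matched_pair (K : fieldType) (U F : hopfAlgType K)
    (act : U -> F -> F) (rho : U -> tensor U F) : Prop := MatchedPair {
  mp_module : left_module act;
  mp_module_alg1 : forall u, act u 1 = (counit u)%:A;
  mp_module_algM : forall u f h,
    act u (f * h) = \sw_(u1, u2 <- comult u) (act u1 f * act u2 h);
  mp_comodule : right_coaction rho;
  mp_comodule_coalg : forall u,
    \sw_(u0, u1 <- rho u) \sw_(u01, u02 <- comult u0) (u01 \ox u02 \ox u1) =
    \sw_(u1, u2 <- comult u) \sw_(u10, u11 <- rho u1) \sw_(u20, u21 <- rho u2)
      (u10 \ox u20 \ox (u11 * u21));
  mp_comodule_counit : forall u,
    \sw_(u0, u1 <- rho u) (counit u0 *: u1) = (counit u)%:A;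
  mp_counit : forall u f, counit (act u f) = counit u * counit f;
  mp_comult : forall u f,
    comult (act u f) =
    \sw_(u1, u2 <- comult u) \sw_(u10, u11 <- rho u1) \sw_(f1, f2 <- comult f)
      (act u10 f1 \ox (u11 * act u2 f2));
  mp_coact1 : rho 1 = 1 \ox 1;
  mp_coactM : coact_mul act rho;
  mp_compat : forall u f,
    \sw_(u1, u2 <- comult u) \sw_(u20, u21 <- rho u2) (u20 \ox (act u1 f * u21)) =
    \sw_(u1, u2 <- comult u) \sw_(u10, u11 <- rho u1) (u10 \ox (u11 * act u2 f))
}.

Definition coact_on_gen (K : fieldType) (g : lieAlgType K) (F : lmodType K)
    (rho : g -> tensor g F) (Rho : Ug g -> tensor (Ug g) F) : Prop :=
  forall X : g,
    Rho (env_gen X) = \sw_(X0, X1 <- rho X) ((env_gen X0 : Ug g) \ox X1).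

(* The conditions determine [Act] and [Rho] from [act] and [rho]. *)
Record extends_to_Ug (K : fieldType) (g : lieAlgType K) (F : hopfAlgType K)
    (act : g -> F -> F) (rho : g -> tensor g F)
    (Act : Ug g -> F -> F) (Rho : Ug g -> tensor (Ug g) F) : Prop := ExtendsToUg {
  ext_module : left_module Act;
  ext_act : forall (X : g) f, Act (env_gen X) f = act X f;
  ext_coact_linear : linear Rho;
  ext_coact : coact_on_gen rho Rho;
  ext_coact1 : Rho 1 = 1 \ox 1;
  ext_coactM : coact_mul Act Rho
}.

(* Main.v *)
Require Import Defs.
From HB Require Import structures.
From mathcomp Require Import all_boot all_order all_algebra.
From mathcomp Require Import boolp functions.
From mathcomp Require Import reals.
From mathcomp Require Import complex.

Set Implicit Arguments.
Unset Strict Implicit.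
Unset Printing Implicit Defensive.

Import GRing.Theory.
Local Open Scope ring_scope.

(** Everything on U(g) is proved by induction on words in elements of g, an
    identity for [x * u] being obtained by applying a fixed operator attached to
    x to the identity for u.

    Forward direction: x in g acts on the tensor product of U(g) and F by
    [gen_step]; the structure identity says exactly that this is a Lie algebra
    action, hence U(g) acts, and the coaction is [u |-> u . (1 \ox 1)].

    Converse: the comodule coalgebra axiom makes the coaction of x in g primitive
    in its U(g)-factor.  The operator [env_square = m \o comult] acts as 2 ^ n on
    the n-th layer of the standard filtration of U(g), but doubles primitive
    elements, so in characteristic 0 the coaction of x comes from g and F alone.
    To restrict the axioms to g one needs g to embed in U(g): sorting words in a
    basis of g by the relations of U(g) and keeping only the letter left at the
    end gives a linear retraction of U(g) onto g. *)

(** * Linear maps and the Lie bracket *)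

Section LinearFun.
Variables (K : fieldType) (V W : lmodType K) (h : V -> W).
Hypothesis hl : linear h.
Let hL : {linear V -> W} := HB.pack h (GRing.isLinear.Build _ _ _ _ h hl).

Lemma lin0 : h 0 = 0. Proof. exact: (linear0 hL). Qed.
Lemma linD x y : h (x + y) = h x + h y. Proof. exact: (linearD hL). Qed.
Lemma linN x : h (- x) = - h x. Proof. exact: (linearN hL). Qed.
Lemma linB x y : h (x - y) = h x - h y. Proof. exact: (linearB hL). Qed.
Lemma linZ a x : h (a *: x) = a *: h x. Proof. exact: (linearZ_LR hL). Qed.
Lemma lin_sum (I : Type) (r : seq I) (P : pred I) (E : I -> V) :
  h (\sum_(i <- r | P i) E i) = \sum_(i <- r | P i) h (E i).
Proof. exact: (linear_sum hL). Qed.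

End LinearFun.

Section LieBracket.
Variables (K : fieldType) (g : lieAlgType K).

Lemma bracket_bilin : bilin (@bracket K g).
Proof. by split; [apply: bracket_linl|apply: bracket_linr]. Qed.

Lemma bracketC (x y : g) : bracket y x = - bracket x y.
Proof.
apply/eqP; rewrite -addr_eq0 -(bracketxx (x + y)).
rewrite (bilinDl bracket_bilin) !(bilinDr bracket_bilin) !bracketxx add0r addr0 addrC.
exact/eqP.
Qed.

(** The form of the Jacobi identity that arises when three letters are sorted in two ways. *)
Lemma jacobi_l (x y z : g) :
  bracket (bracket x z) y = bracket (bracket y z) x + bracket (bracket x y) z.
Proof.
rewrite (bracketC y (bracket x z)) (bracketC x (bracket y z)) (bracketC z (bracket x y)).
rewrite (bracketC z x) (linN (bracket_bilin.2 y)) opprK -opprD.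
by apply/eqP; rewrite eq_sym eqr_oppLR -addr_eq0 addrAC jacobi.
Qed.

End LieBracket.

(** * Actions of the enveloping algebra *)

Section EnvelopeAct.
Variables (K : fieldType) (g : lieAlgType K) (M : lmodType K).
Variables (S : M -> Prop) (phi : g -> M -> M).
Hypothesis S_linear : forall a m m', S m -> S m' -> S (a *: m + m').
Hypothesis S_phi : forall x m, S m -> S (phi x m).
Hypothesis phi_bilin : bilin phi.
Hypothesis phi_bracket : forall x y m, S m ->
  phi (bracket x y) m = phi x (phi y m) - phi y (phi x m).

(** Terms act on vectors directly, and the bracket relation is asked only on [S]: for functions on
    words it holds only for those that obey the relations of U(g). *)
Fixpoint uterm_act (t : uterm g) (m : M) : M :=
  match t with
  | UGen x => phi x m
  | UScal a => a *: m
  | UAdd s t => uterm_act s m + uterm_act t m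
  | UMul s t => uterm_act s (uterm_act t m)
  end.

Definition env_act (u : envelope g) (m : M) : M := uterm_act (urepr u) m.

Lemma uterm_act_linear t : linear (uterm_act t).
Proof.
elim: t => [x|b|s ihs t iht|s ihs t iht] a m m' /=.
- exact: phi_bilin.2.
- by rewrite scalerDr !scalerA mulrC.
- by rewrite ihs iht scalerDr addrACA.
- by rewrite iht ihs.
Qed.

Lemma uterm_act_sub t m : S m -> S (uterm_act t m).
Proof.
elim: t m => [x|b|s ihs t iht|s ihs t iht] m Sm /=.
- exact: S_phi.
(* Only combinations [a *: m + m'] are known to stay in [S], so [b *: m] is read as
   [(b - 1) *: m + m]. *)
- by rewrite -[b](subrK 1) scalerDl scale1r; apply: S_linear.
- by rewrite -[uterm_act s m]scale1r; apply: S_linear; [apply: ihs|apply: iht].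
- exact/ihs/iht.
Qed.

Lemma uterm_act_ueq s t : ueq s t -> forall m, S m -> uterm_act s m = uterm_act t m.
Proof.
have actD t' m m' : uterm_act t' (m + m') = uterm_act t' m + uterm_act t' m'.
  by have := uterm_act_linear t' 1 m m'; rewrite !scale1r.
have act0 t' : uterm_act t' 0 = 0.
  by apply: (addrI (uterm_act t' 0)); rewrite -actD !addr0.
have actZ t' a m : uterm_act t' (a *: m) = a *: uterm_act t' m.
  by have := uterm_act_linear t' a m 0; rewrite act0 !addr0.
elim=> {s t} /=.
- by [].
- by move=> s t _ e m Sm; rewrite e.
- by move=> s t u _ e _ e' m Sm; rewrite e // e'.
- by move=> s s' t t' _ e _ e' m Sm; rewrite e // e'.
- by move=> s s' t t' _ e _ e' m Sm; rewrite e' // e //; apply: uterm_act_sub.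
- by move=> s t u m _; rewrite addrA.
- by move=> s t m _; rewrite addrC.
- by move=> s m _; rewrite scale0r add0r.
- by move=> s m _; rewrite scaleN1r addNr scale0r.
- by [].
- by move=> s m _; rewrite scale1r.
- by [].
- by move=> s t u m _; rewrite actD.
- by move=> a s m _; rewrite actZ.
- by move=> a b m _; rewrite scalerDl.
- by move=> a b m _; rewrite scalerA.
- by move=> x y m _; rewrite (bilinDl phi_bilin).
- by move=> a x m _; rewrite (bilinZl phi_bilin).
- by move=> x y m Sm; rewrite phi_bracket // subrK.
Qed.

Lemma env_act_of s m : S m -> env_act (env_of s) m = uterm_act s m.
Proof. exact/uterm_act_ueq/ueq_repr. Qed.

Lemma env_act_gen x m : S m -> env_act (env_gen x) m = phi x m.
Proof. exact: env_act_of. Qed.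

Lemma env_act1 m : S m -> env_act 1 m = m.
Proof.
by move=> Sm; rewrite -[1]/(env_of (UScal _ 1)) env_act_of //= scale1r.
Qed.

Lemma env_actM u v m : S m -> env_act (u * v) m = env_act u (env_act v m).
Proof.
move=> Sm; have Svm : S (env_act v m) by apply: uterm_act_sub.
rewrite -(ureprK u) env_act_of // -{1}(ureprK v) -[_ * _]env_ofM env_act_of //=.
Qed.

Lemma env_act_linearl m : S m -> linear (env_act^~ m).
Proof.
move=> Sm a u v; rewrite -(ureprK u) -(ureprK v).
by rewrite -[_ *: _]env_ofM -[_ + _]env_ofD !env_act_of.
Qed.

Lemma env_act_linearr u : linear (env_act u).
Proof. exact: uterm_act_linear. Qed.

End EnvelopeAct.

(** * Retraction of the enveloping algebra onto the Lie algebra *)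

Section Straightening.
Variables (K : fieldType) (g : finLieAlgType K).
Let n := \dim (fullv : {vspace g}).
Let X : n.-tuple g := vbasis fullv.
Local Notation word := (seq 'I_n).

(** Words index a basis of the tensor algebra of g; this is the linear extension of [s] evaluated at
    the tensor of [a], [x] and [b]. *)
Definition word_ext (s : word -> g) (a : word) (x : g) (b : word) : g :=
  \sum_(k < n) coord X k x *: s (a ++ k :: b).

Definition word_bracket (s : word -> g) a (i j : 'I_n) b : g :=
  word_ext s a (bracket X`_i X`_j) b.

(** The defining relation of U(g) for two letters, between the contexts [a] and [b]. *)
Definition straight_at (s : word -> g) a i j b : Prop :=
  s (a ++ i :: j :: b) = s (a ++ j :: i :: b) + word_bracket s a i j b.

Fixpoint first_descent (w : word) : option (word * 'I_n * 'I_n * word) :=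
  if w is i :: w' then
    if w' is j :: b then
      if (j < i)%N then Some ([::], i, j, b) else
      if first_descent w' is Some (a, i', j', b') then Some (i :: a, i', j', b')
      else None
    else None
  else None.

Fixpoint inversions (w : word) : nat :=
  if w is i :: w' then (count (fun j : 'I_n => j < i)%N w' + inversions w')%N else 0%N.

(** [m] is fuel, meant to be the number of inversions, and [s] supplies the values on words one
    letter shorter. A sorted word of two or more letters has no part in g, hence the value 0. *)
Fixpoint straighten (m : nat) (s : word -> g) (w : word) : g :=
  if m is m'.+1 then
    if first_descent w is Some (a, i, j, b) then
      straighten m' s (a ++ j :: i :: b) + word_bracket s a i j b
    else 0
  else 0.

(** Meaningful on words of length [l] only. The recursion is on the length because a bracket merges
    two letters into one. *)
Fixpoint letter_part_len (l : nat) (w : word) : g :=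
  match l with
  | 0%N => 0
  | 1%N => if w is k :: _ then X`_k else 0
  | l'.+1 => straighten (inversions w) (letter_part_len l') w
  end.

Definition letter_part (w : word) : g := letter_part_len (size w) w.

(** Only the exchanged pair changes its relative order. A drop by exactly one keeps the fuel of
    [straighten] equal to the number of inversions. *)
Lemma inversions_swap (a b : word) (i j : 'I_n) : (j < i)%N ->
  inversions (a ++ i :: j :: b) = (inversions (a ++ j :: i :: b)).+1.
Proof.
move=> ji; elim: a => [|k a ih] /=.
  rewrite ji ltnNge (ltnW ji) /= add0n add1n addSn; congr _.+1.
  by rewrite addnCA.
rewrite ih addnS; congr (_ + _).+1.
by rewrite !count_cat /= (addnCA (i < k)%N).
Qed.

Lemma first_descentSS i j b : first_descent [:: i, j & b] =
  if (j < i)%N then Some ([::], i, j, b)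
  else if first_descent (j :: b) is Some (a, i', j', b') then Some (i :: a, i', j', b')
  else None.
Proof. by []. Qed.

Lemma first_descentP w a i j b : first_descent w = Some (a, i, j, b) ->
  [/\ w = a ++ i :: j :: b, (j < i)%N &
      forall a' i' j' b', w = a' ++ i' :: j' :: b' -> (j' < i')%N ->
        (size a <= size a')%N].
Proof.
elim: w a => [//|i0 [//|j0 w] ih] a.
rewrite first_descentSS; case: ifP => [ji [<- <- <- <-]|ji].
  by split.
case e: (first_descent _) => [[[[a1 i1] j1] b1]|] //= [<- e1 e2 e3].
rewrite {}e1 {}e2 {}e3 in e; have {ih} [ew lt h] := ih _ e; split=> // [|[|k a'] i' j' b' /=].
  by rewrite ew.
  by case=> <- <- _; rewrite ji.
by case=> _ e' lt'; rewrite ltnS; apply: h e' lt'.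
Qed.

Lemma first_descent_ex (a b : word) (i j : 'I_n) : (j < i)%N ->
  exists p, first_descent (a ++ i :: j :: b) = Some p.
Proof.
move=> ji; elim: a => [|k a [[[[a1 i1] j1] b1] ih]].
  by rewrite /= ji; eexists.
case: a ih => [|k' a] ih.
  rewrite [_ ++ _]/= first_descentSS [first_descent _]ih.
  by case: ifP => _; eexists.
rewrite [_ ++ _]/= first_descentSS [first_descent _]ih.
by case: ifP => _; eexists.
Qed.

Lemma straightenS m s w : straighten m.+1 s w =
  if first_descent w is Some (a, i, j, b) then
    straighten m s (a ++ j :: i :: b) + word_bracket s a i j b
  else 0.
Proof. by []. Qed.

Lemma letter_part_lenSS l w :
  letter_part_len l.+2 w = straighten (inversions w) (letter_part_len l.+1) w.
Proof. by []. Qed.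

(** At the first descent the relation is [straighten] unfolded once. *)
Lemma letter_part_step w a i j b :
  first_descent w = Some (a, i, j, b) -> straight_at letter_part a i j b.
Proof.
move=> e; have [ew ji _] := first_descentP e.
rewrite ew in e; rewrite /straight_at /letter_part /word_bracket /word_ext.
have -> : size (a ++ i :: j :: b) = (size a + size b).+2.
  by rewrite size_cat /= !addnS.
have -> : size (a ++ j :: i :: b) = (size a + size b).+2.
  by rewrite size_cat /= !addnS.
rewrite !letter_part_lenSS inversions_swap // straightenS e; congr (_ + _).
by apply: eq_bigr => k _; rewrite size_cat /= addnS.
Qed.

Lemma word_ext_linear s a b : linear (fun x => word_ext s a x b).
Proof.
move=> c x y; rewrite /word_ext scaler_sumr -big_split; apply: eq_bigr => k _ /=.
by rewrite linearP scalerDl scalerA.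
Qed.

Let s := letter_part.

Lemma straight_atC a i j b : straight_at s a i j b -> straight_at s a j i b.
Proof.
have wl := word_ext_linear s a b.
rewrite /straight_at /word_bracket (bracketC X`_i) (linN wl) => ->.
by rewrite addrK.
Qed.

(** * Induction step: words of length l with m inversions *)

Section Step.
Variables (l m : nat).
Hypothesis short : forall (a : word) (i j : 'I_n) (b : word),
    ((size a + size b).+2 < l)%N -> straight_at s a i j b.
Hypothesis less : forall (a : word) (i j : 'I_n) (b : word),
  (size a + size b).+2 = l -> (j < i)%N ->
  (inversions (a ++ i :: j :: b) < m)%N -> straight_at s a i j b.

(** By linearity in [x] this is the relation between two letters, available because the words are
    shorter than [l]. *)
Lemma short_ext (a : word) x (i : 'I_n) (b : word) : (((size a + size b).+2 < l)%N) ->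
  word_ext s a x (i :: b) = word_ext s (a ++ [:: i]) x b + word_ext s a (bracket x X`_i) b.
Proof.
move=> lt; rewrite {1}/word_ext.
under eq_bigr => k _ do rewrite (short _ _ lt) scalerDr.
rewrite big_split /=; congr (_ + _).
  by apply: eq_bigr => k _; rewrite -catA.
rewrite [in RHS](coord_basis (vbasisP _) (memvf x)).
rewrite (lin_sum ((bracket_bilin g).1 _)) (lin_sum (word_ext_linear _ _ _)).
apply: eq_bigr => k _.
by rewrite (bilinZl (bracket_bilin g)) (linZ (word_ext_linear _ _ _)).
Qed.

Lemma short_ext2 (a c b : word) (x : g) (i j : 'I_n) :
  ((size a + size (c ++ b)).+3 < l)%N ->
  word_ext s a x (c ++ i :: j :: b) = word_ext s a x (c ++ j :: i :: b) +
    \sum_(k < n) coord X k x *: word_bracket s (a ++ k :: c) i j b.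
Proof.
move=> lt; rewrite /word_ext -big_split; apply: eq_bigr => k _ /=.
rewrite -scalerDr; congr (_ *: _).
have : straight_at s (a ++ k :: c) i j b.
  by apply: short; rewrite size_cat /= addnS addSn -addnA -size_cat.
by rewrite /straight_at -!catA.
Qed.

Lemma short_ext3 (a c b : word) (y : g) (i j : 'I_n) :
  ((size a + size (c ++ b)).+3 < l)%N ->
  word_ext s (a ++ i :: j :: c) y b = word_ext s (a ++ j :: i :: c) y b +
    \sum_(k < n) coord X k y *: word_bracket s a i j (c ++ k :: b).
Proof.
move=> lt; rewrite /word_ext -big_split; apply: eq_bigr => k _ /=.
rewrite -scalerDr; congr (_ *: _); rewrite -!catA.
apply: short; apply: leq_ltn_trans lt; by rewrite !size_cat /= !addnS.
Qed.

(** Both sides are the linear extension of [s] at the tensor of [a], [x], [c], [y] and [b]. With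
    brackets for [x] and [y] it is the remainder left by two disjoint descents. *)
Lemma word_ext_comm (a c b : word) (x y : g) :
  \sum_(k < n) coord X k x *: word_ext s (a ++ k :: c) y b =
  \sum_(k < n) coord X k y *: word_ext s a x (c ++ k :: b).
Proof.
rewrite /word_ext; under eq_bigr do rewrite scaler_sumr.
under [RHS]eq_bigr do rewrite scaler_sumr.
rewrite exchange_big; apply: eq_bigr => k _ /=; apply: eq_bigr => k' _.
by rewrite !scalerA mulrC -catA.
Qed.

(** The two exchanges commute: after either one the other is available from [less], an inversion
    being gone, and the term with both pairs replaced by brackets is the same in either order. *)
Lemma straight_disjoint (a c b : word) (i j i' j' : 'I_n) :
  (size a + size (c ++ b)).+4 = l -> (j < i)%N -> (j' < i')%N ->
  inversions (a ++ i :: j :: c ++ i' :: j' :: b) = m ->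
  straight_at s a i j (c ++ i' :: j' :: b) -> straight_at s (a ++ i :: j :: c) i' j' b.
Proof.
move=> el ji ji' em F1.
have F2 : straight_at s (a ++ j :: i :: c) i' j' b.
  apply: less => //; first by rewrite -el !size_cat /= !addnS !addSn addnA.
  by rewrite -em [in X in (_ < X)%N]inversions_swap // -catA.
have F3 : straight_at s a i j (c ++ j' :: i' :: b).
  apply: less => //; first by rewrite -el !size_cat /= !addnS.
  have := inversions_swap (a ++ i :: j :: c) b ji'; rewrite -!catA /= em => ->.
  exact: ltnSn.
move: F1 F2 F3; rewrite /straight_at -!catA /= => -> -> ->.
have lt : ((size a + size (c ++ b)).+3 < l)%N by rewrite -el.
rewrite /word_bracket (short_ext2 _ _ _ lt) (short_ext3 _ i j lt).
rewrite word_ext_comm -!addrA; congr (_ + _).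
by rewrite [LHS]addrCA -?addrA.
Qed.

(* The two ways of sorting three letters differ by an instance of the Jacobi
   identity. *)
Lemma straight_overlap (a b : word) (i j k : 'I_n) :
  (size a + size b).+3 = l -> (j < i)%N -> (k < j)%N ->
  inversions (a ++ [:: i, j, k & b]) = m ->
  straight_at s a i j (k :: b) -> straight_at s (a ++ [:: i]) j k b.
Proof.
move=> el ji kj em G1; have ki := ltn_trans kj ji.
(* Every exchange on the way from [i j k] to [k j i] loses one inversion, so [less] gives all
   relations except the two at [i j k] itself: one is assumed, the other is the goal. *)
have em1 : m = (inversions (a ++ [:: j, i, k & b])).+1.
  by rewrite -em inversions_swap.
have em2 : m = (inversions (a ++ [:: i, k, j & b])).+1.
  by rewrite -em; have := inversions_swap (a ++ [:: i]) b kj; rewrite -!catA.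
have em3 : inversions (a ++ [:: j, i, k & b]) = (inversions (a ++ [:: j, k, i & b])).+1.
  by have := inversions_swap (a ++ [:: j]) b ki; rewrite -!catA.
have em4 : inversions (a ++ [:: i, k, j & b]) = (inversions (a ++ [:: k, i, j & b])).+1.
  by rewrite inversions_swap.
have sz (x y : 'I_n) : (size (a ++ [:: x]) + size b).+2 = l /\ (size a + size (y :: b)).+2 = l.
  by rewrite size_cat addn1 addSn /= addnS.
have G2 : straight_at s (a ++ [:: j]) i k b.
  by apply: less; rewrite -?catA ?em1 ?(sz j j).1.
have G3 : straight_at s a j k (i :: b).
  by apply: less; rewrite ?em1 ?em3 ?(sz j i).2 // ltnW.
have G4 : straight_at s a i k (j :: b).
  by apply: less; rewrite ?em2 ?(sz j j).2.
have G5 : straight_at s (a ++ [:: k]) i j b.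
  by apply: less; rewrite -?catA ?em2 ?em4 ?(sz k i).1 // ltnW.
have lt : ((size a + size b).+2 < l)%N by rewrite -el.
move: G1 G2 G3 G4 G5; rewrite /straight_at /word_bracket -!catA !cat1s => -> -> -> -> ->.
rewrite !(short_ext _ _ lt) jacobi_l (linD (word_ext_linear _ _ _)) -!addrA; congr (_ + _).
rewrite (bracketC X`_i X`_j) (linN ((bracket_bilin g).1 _)) (linN (word_ext_linear _ _ _)).
set P := word_ext s (a ++ [:: i]) _ _; set Q := word_ext s a (bracket _ X`_j) _.
set R := word_ext s a _ _; set T := word_ext s (a ++ [:: j]) _ _.
set V := word_ext s (a ++ [:: k]) _ _.
by rewrite [V + R]addrC [T + _]addrCA addKr addrA addrC [P + Q]addrC [T + V]addrC -addrA.
Qed.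

Lemma cat_eq_split (a0 a u v : word) x : a0 ++ x :: u = a ++ v -> (size a0 < size a)%N ->
  exists2 a1, a = a0 ++ x :: a1 & u = a1 ++ v.
Proof.
elim: a0 a => [|y a0 ih] [|z a] //=; first by case=> -> ->; exists a.
by case=> -> /ih e; rewrite ltnS => /e [a1 -> ->]; exists a1.
Qed.

(** [letter_part_step] gives the relation at the first descent. Any other descent lies to its right,
    and either shares a letter with it or is disjoint from it. *)
Lemma straight_less (a b : word) (i j : 'I_n) :
  (size a + size b).+2 = l -> (j < i)%N -> inversions (a ++ i :: j :: b) = m ->
  straight_at s a i j b.
Proof.
move=> el ji em; have [[[[a0 i0] j0] b0] e] := first_descent_ex a b ji.
have [ew ji0 min] := first_descentP e; have := min _ _ _ _ erefl ji.
have step := letter_part_step e; rewrite leq_eqVlt => /orP [/eqP ea|lt].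
  have /eqP := ew; rewrite eqseq_cat // eq_sym => /andP [/eqP ea0].
  by rewrite !eqseq_cons => /and3P [/eqP -> /eqP -> /eqP ->]; rewrite -ea0 in step *.
(* If nothing stands between [i0] and [i], then [j0 = i] and the two descents overlap. *)
have [[|k c] ea] := cat_eq_split (esym ew) lt.
  case=> ej eb; rewrite ea; apply: straight_overlap => //.
  - by rewrite -el ea size_cat addn1.
  - by rewrite -ej.
  - by rewrite -em ea -catA.
  - by rewrite -ej -eb.
case=> ek eb; rewrite ea -ek; apply: straight_disjoint => //.
- by rewrite -el ea !size_cat /= !addnS !addSn addnA.
- by rewrite -em ea -ek -catA.
- by rewrite -eb.
Qed.

End Step.

Lemma straight_descent l m (a b : word) (i j : 'I_n) :
  (forall (a : word) (i j : 'I_n) (b : word),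
    ((size a + size b).+2 < l)%N -> straight_at s a i j b) ->
  (size a + size b).+2 = l -> (j < i)%N -> inversions (a ++ i :: j :: b) = m ->
  straight_at s a i j b.
Proof.
move=> short; have [m'] := ubnP m; elim: m' => // m' ih in m a b i j *.
rewrite ltnS => lm el ji em; apply: (straight_less short _ el ji em).
move=> a1 i1 j1 b1 el1 ji1 lt1; apply: ih el1 ji1 erefl.
exact: leq_trans lt1 lm.
Qed.

(** Strong induction on the length. Antisymmetry of the bracket turns an ascent into a descent, and
    for equal letters the bracket vanishes. *)
Lemma letter_part_straight (a b : word) (i j : 'I_n) : straight_at s a i j b.
Proof.
have [l] := ubnP (size a + size b).+2; elim: l => // l ih in a b i j *.
rewrite ltnS leq_eqVlt => /orP [/eqP el|]; last exact: ih.
have [ij|ji|/val_inj ->] := ltngtP i j.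
- by apply/straight_atC/(straight_descent _ el ij erefl) => ? ? ? ?; apply: ih.
- by apply/(straight_descent _ el ji erefl) => ? ? ? ?; apply: ih.
- by rewrite /straight_at /word_bracket bracketxx (lin0 (word_ext_linear _ _ _)) addr0.
Qed.

(* The functions on words obeying the relations of U(g) form a module on which
   [X`_k] acts by appending the letter k; evaluating at the empty word the image
   of [letter_part] recovers the degree one part of an element of U(g). *)
Let straight (f : word -> g) : Prop := forall a i j b, straight_at f a i j b.
Let append (x : g) (f : word -> g) : word -> g := fun w => word_ext f w x [::].

Let fun_lin c (f h : word -> g) w : (c *: f + h) w = c *: f w + h w.
Proof. by []. Qed.

Let fun_sub (f h : word -> g) w : (f - h) w = f w - h w.
Proof. by []. Qed.

Let straight_linear c f h : straight f -> straight h -> straight (c *: f + h).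
Proof.
move=> sf sh a i j b; rewrite /straight_at /word_bracket.
have -> x : word_ext (c *: f + h) a x b = c *: word_ext f a x b + word_ext h a x b.
  rewrite /word_ext scaler_sumr -big_split; apply: eq_bigr => k _ /=.
  by rewrite fun_lin scalerDr !scalerA mulrC.
by rewrite !fun_lin sf sh scalerDr addrACA.
Qed.

Let append_bilin : bilin append.
Proof.
split=> [f|x] c y z; apply/funext => w.
  exact: word_ext_linear.
rewrite fun_lin /append /word_ext scaler_sumr -big_split; apply: eq_bigr => k _ /=.
by rewrite fun_lin scalerDr !scalerA mulrC.
Qed.

(** Appending only lengthens the right context of a relation. *)
Let straight_append x f : straight f -> straight (append x f).
Proof.
move=> sf a i j b; rewrite /straight_at /word_bracket /append /word_ext.
under [X in _ = _ + X]eq_bigr do rewrite scaler_sumr.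
rewrite [X in _ = _ + X]exchange_big -big_split; apply: eq_bigr => k _ /=.
rewrite -!catA /= sf scalerDr scaler_sumr; congr (_ + _); apply: eq_bigr => k' _.
by rewrite !scalerA mulrC -catA.
Qed.

Let append_basis (k : 'I_n) f (w : word) : append X`_k f w = f (w ++ [:: k]).
Proof.
rewrite /append /word_ext (bigD1 k) //= big1 ?addr0 => [|k' /negbTE nk].
  by rewrite coord_free ?(basis_free (vbasisP _)) // eqxx scale1r.
by rewrite coord_free ?(basis_free (vbasisP _)) // eq_sym nk scale0r.
Qed.

(** By bilinearity [x] and [y] may be taken in the basis, and then this is the relation between the
    last two letters of a word. *)
Let append_bracket x y f : straight f ->
  append (bracket x y) f = append x (append y f) - append y (append x f).
Proof.
move=> sf; have bb := bracket_bilin g.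
have lx z : linear (fun x => append x (append z f)).
  exact: append_bilin.1.
have lx' z : linear (fun x => append z (append x f)).
  apply: (lin_comp (append_bilin.2 z)); exact: append_bilin.1.
have lf : linear (append^~ f) by apply: append_bilin.1.
rewrite (coord_basis (vbasisP _) (memvf x)).
rewrite (lin_sum (bb.1 y)) (lin_sum lf) (lin_sum (lx y)) (lin_sum (lx' y)) -sumrB.
apply: eq_bigr => i _.
rewrite (linZ (bb.1 y)) (linZ lf) (linZ (lx y)) (linZ (lx' y)) -scalerBr; congr (_ *: _).
rewrite (coord_basis (vbasisP _) (memvf y)).
rewrite (lin_sum (bb.2 _)) (lin_sum lf) (lin_sum (lx _)) (lin_sum (lx' _)) -sumrB.
apply: eq_bigr => j _.
rewrite (linZ (bb.2 _)) (linZ lf) (linZ (lx _)) (linZ (lx' _)) -scalerBr; congr (_ *: _).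
apply/funext => w; rewrite fun_sub !append_basis -!catA /= sf.
by rewrite addrC addKr.
Qed.

Definition env_retract (u : envelope g) : g := env_act append u letter_part [::].

Lemma env_retract_linear : linear env_retract.
Proof.
move=> c u v; rewrite /env_retract.
rewrite (env_act_linearl straight_linear straight_append append_bilin append_bracket) //.
by move=> a i j b; apply: letter_part_straight.
Qed.

(** A one-letter word is its own letter part. This is the injectivity statement of the
    Poincare-Birkhoff-Witt theorem. *)
Lemma env_genK : cancel (@env_gen K g) env_retract.
Proof.
move=> x; rewrite /env_retract.
rewrite (env_act_gen straight_linear straight_append append_bilin append_bracket).
  rewrite [RHS](coord_basis (vbasisP _) (memvf x)) /append /word_ext /=.
  exact: eq_bigr.
by move=> a i j b; apply: letter_part_straight.
Qed.

End Straightening.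

(** * Sweedler calculus *)

Lemma tensor_ext (K : fieldType) (V W Z : lmodType K) (h k : tensor V W -> Z) :
  linear h -> linear k -> (forall v w, h (v \ox w) = k (v \ox w)) -> h =1 k.
Proof.
move=> hl kl e; elim/tensor_ind => [|v w t ih]; first by rewrite !lin0.
by rewrite (linD hl) (linD kl) ih e.
Qed.

Lemma sweedler_exchange (K : fieldType) (V W V' W' : lmodType K) (Z : zmodType)
    (s : tensor V W) (t : tensor V' W') (f : V -> W -> V' -> W' -> Z) :
  \sw_(v, w <- s) \sw_(v', w' <- t) f v w v' w' =
  \sw_(v', w' <- t) \sw_(v, w <- s) f v w v' w'.
Proof. exact: exchange_big. Qed.

Lemma lin_opp (K : fieldType) (V W : lmodType K) (h : V -> W) :
  linear h -> linear (fun x => - h x).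
Proof. by move=> hl a x y; rewrite hl opprD scalerN. Qed.

Lemma lin_counit (K : fieldType) (V : lmodType K) (A : hopfAlgType K) (h : V -> A) :
  linear h -> scalar (fun x => counit (h x)).
Proof. by move=> hl a x y; rewrite hl counit_linear. Qed.

(** Extends [lin] by the Hopf structure maps and by the linear and bilinear maps found in the
    context; hence the many [Let] and [have] that only record linearity. *)
Ltac mlin := repeat first
  [ lin_step
  | match goal with
    | H : bilin ?f |- GRing.linear_for _ (fun x => ?f (@?h x) ?z) => apply: (lin_bilinl _ H)
    | H : bilin ?f |- GRing.linear_for _ (fun x => ?f ?z (@?h x)) => apply: (lin_bilinr _ H)
    | |- GRing.linear_for _ comult => exact: comult_linear
    | |- GRing.linear_for _ (fun x => comult (@?h x)) => apply: (lin_comp (@comult_linear _ _))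
    | |- GRing.linear_for _ counit => exact: counit_linear
    | |- GRing.linear_for _ (fun x => counit (@?h x)) => apply: lin_counit
    | |- GRing.linear_for _ (fun x => - (@?h x)) => apply: lin_opp
    | H : bilin ?f |- GRing.linear_for _ (?f ?z) => exact: (H.2 z)
    | H : linear ?f |- GRing.linear_for _ (fun x => ?f (@?h x)) => apply: (lin_comp H)
    end
].

(** * Hopf structure of U(g) on words *)

Section UgWords.
Variables (K : fieldType) (g : lieAlgType K).
Definition Ugen (x : g) : Ug g := env_gen x.

Lemma Ugen_linear : linear Ugen. Proof. exact: env_gen_linear. Qed.

Lemma Ug_word_ind (P : Ug g -> Prop) :
  P 1 -> (forall a u v, P u -> P v -> P (a *: u + v)) ->
  (forall x u, P u -> P (Ugen x * u)) -> forall u, P u.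
Proof.
move=> P1 PD Px u; rewrite -[u]mulr1.
(* The factor 1 is generalized to any [w] with [P w], so that the product case goes through. *)
elim/envelope_ind: u 1 P1 => [x||a u v ihu ihv|u v ihu ihv] w Pw.
- exact: Px.
- by rewrite mul1r.
- by rewrite mulrDl -scalerAl; apply: PD; [apply: ihu|apply: ihv].
- by rewrite -mulrA; apply/ihu/ihv.
Qed.

Lemma sw_comult_Ugen (Z : lmodType K) (k : Ug g -> Ug g -> Z) x u : bilin k ->
  sweedler (comult (Ugen x * u)) k =
  \sw_(a, b <- comult u) (k (Ugen x * a) b + k a (Ugen x * b)).
Proof.
move=> kb; rewrite comultM (sweedler_tmul _ _ kb) Ug_comult_gen.
have kb' : bilin (fun a b : Ug g => \sw_(a', b' <- comult u) k (a * a') (b * b')) by mlin.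
rewrite (sweedlerD kb') !(sweedler_pure kb') -sweedler_add.
by apply: eq_sweedler => a b; rewrite !mul1r.
Qed.

Lemma sw_comult1 (Z : lmodType K) (k : Ug g -> Ug g -> Z) : bilin k ->
  sweedler (comult 1) k = k 1 1.
Proof. by move=> kb; rewrite comult1 sweedler_pure. Qed.

Lemma counit_Ugen x (u : Ug g) : counit (Ugen x * u) = 0.
Proof. by rewrite counitM Ug_counit_gen mul0r. Qed.

Lemma Ugen_bracket x y : Ugen (bracket x y) = Ugen x * Ugen y - Ugen y * Ugen x.
Proof. exact: env_gen_bracket. Qed.

(** Generators are primitive. The induction keeps [k] arbitrary because each letter of [u] changes
    it. *)
Lemma Ug_cocomm (Z : lmodType K) (k : Ug g -> Ug g -> Z) u : bilin k ->
  \sw_(a, b <- comult u) k a b = \sw_(a, b <- comult u) k b a.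
Proof.
elim/Ug_word_ind: u k => [|c u v ihu ihv|x u ih] k kb.
- by rewrite !sw_comult1 //; mlin.
- have kb' : bilin (fun a b => k b a) by mlin.
  rewrite comult_linear (sweedlerD kb) (sweedlerZ kb) (sweedlerD kb') (sweedlerZ kb').
  by rewrite (ihu _ kb) (ihv _ kb).
- have kb' : bilin (fun a b => k b a) by mlin.
  rewrite (sw_comult_Ugen _ _ kb) (sw_comult_Ugen _ _ kb').
  rewrite (ih (fun a b => k (Ugen x * a) b + k a (Ugen x * b))); last by mlin.
  by apply: eq_sweedler => a b; rewrite addrC.
Qed.

End UgWords.

(** * Primitive tensors *)

Section Filtration.
Variables (K : fieldType) (g : lieAlgType K).
Local Notation U := (Ug g).

Inductive env_fil : nat -> U -> Prop :=
| env_fil1 n : env_fil n 1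
| env_filD n a u v : env_fil n u -> env_fil n v -> env_fil n (a *: u + v)
| env_filM n x u : env_fil n u -> env_fil n.+1 (Ugen x * u).

Lemma env_fil0 n : env_fil n 0.
Proof. by rewrite -(addNr 1) -scaleN1r; apply/env_filD/env_fil1/env_fil1. Qed.

Lemma env_filZ n a u : env_fil n u -> env_fil n (a *: u).
Proof. by move=> fu; rewrite -[_ *: _]addr0; apply/env_filD/env_fil0. Qed.

Lemma env_filA n u v : env_fil n u -> env_fil n v -> env_fil n (u + v).
Proof. by move=> fu; rewrite -[u]scale1r; apply: env_filD. Qed.

Lemma env_filS n u : env_fil n u -> env_fil n.+1 u.
Proof.
elim=> {n u} [n|n a u v _ fu _ fv|n x u _ fu]; first exact: env_fil1.
- exact: env_filD.
- exact: env_filM.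
Qed.

Lemma env_filW m n u : (m <= n)%N -> env_fil m u -> env_fil n u.
Proof.
move=> /subnK <-; elim: (n - m)%N => //= k ih fu.
exact/env_filS/ih.
Qed.

Lemma env_fil_mul m n u v : env_fil m u -> env_fil n v -> env_fil (m + n) (u * v).
Proof.
move=> fu fv; elim: fu => {m u} [m|m a u u' _ fu _ fu'|m x u _ fu].
- by rewrite mul1r; apply: env_filW fv; apply: leq_addl.
- by rewrite mulrDl -scalerAl; apply: env_filD.
- by rewrite -mulrA; apply: env_filM.
Qed.

Lemma env_fil_exists u : exists n, env_fil n u.
Proof.
elim/Ug_word_ind: u => [|a u v [m fu] [n fv]|x u [n fu]].
- by exists 0%N; apply: env_fil1.
- exists (m + n)%N; apply: env_filD; first exact: env_filW (leq_addr _ _) fu.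
  exact: env_filW (leq_addl _ _) fv.
- by exists n.+1; apply: env_filM.
Qed.

(** The graded algebra of the filtration is commutative: moving [x] past a letter [y] replaces that
    letter by a bracket, so the layer stays [n] instead of [n.+1]. *)
Lemma env_fil_commutator n u x : env_fil n u -> env_fil n (u * Ugen x - Ugen x * u).
Proof.
elim=> {n u} [n|n a u v _ fu _ fv|n y u fu fu'].
- by rewrite mul1r mulr1 subrr; apply: env_fil0.
- rewrite mulrDl mulrDr -scalerAl -scalerAr opprD addrACA -scalerBr.
  exact: env_filD.
- have -> : Ugen y * u * Ugen x - Ugen x * (Ugen y * u) =
    Ugen y * (u * Ugen x - Ugen x * u) + Ugen (bracket y x) * u.
    by rewrite Ugen_bracket mulrBr mulrBl !mulrA addrA subrK.
  by apply: env_filA; apply: env_filM.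
Qed.

(** The coproduct respects the filtration. The shift [d] counts the letters that the induction has
    moved from [u] into [k]. *)
Lemma env_fil_comult n u : env_fil n u -> forall d (k : U -> U -> U), bilin k ->
  (forall i j a b, env_fil i a -> env_fil j b -> env_fil (i + j + d) (k a b)) ->
  env_fil (n + d) (sweedler (comult u) k).
Proof.
elim=> {n u} [n|n a u v _ fu _ fv|n x u _ fu] d k kb kf.
- rewrite (sw_comult1 kb).
  by have := kf 0%N n _ _ (env_fil1 0) (env_fil1 n).
- rewrite comult_linear (sweedlerD kb) (sweedlerZ kb).
  by apply: env_filD; [apply: fu|apply: fv].
- rewrite (sw_comult_Ugen _ _ kb) addSnnS; apply: fu; first by mlin.
  move=> i j a b fa fb; rewrite addnS -addSn; apply: env_filA.
    by rewrite -addSn; apply: kf => //; apply: env_filM.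
  by rewrite -addnS; apply: kf => //; apply: env_filM.
Qed.

(** The convolution square of the identity, an Adams operation. *)
Definition env_square (u : U) : U := \sw_(a, b <- comult u) (a * b).

Lemma env_square_linear : linear env_square.
Proof. by apply: lin_sw_arg; mlin. Qed.

Lemma env_square_gen x u : env_square (Ugen x * u) =
  2%:R *: (Ugen x * env_square u) + \sw_(a, b <- comult u) ((a * Ugen x - Ugen x * a) * b).
Proof.
rewrite /env_square sw_comult_Ugen; last by mlin.
rewrite (sweedler_comp _ _ (linear_mul (Ugen x))) -sweedler_scale -sweedler_add.
apply: eq_sweedler => a b.
by rewrite scaler_nat mulr2n mulrBl !mulrA -!addrA; congr (_ + _); rewrite addrC subrK.
Qed.

(** By [env_square_gen] each letter contributes a factor 2 up to a commutator term, which lies in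
    the lower layer. Below layer 0 there is only zero, hence the separate equality. *)
Lemma env_square_fil n u : env_fil n u ->
  if n is m.+1 then env_fil m (env_square u - (2 ^ n)%:R *: u) else env_square u = u.
Proof.
have sq1 : env_square 1 = 1 by rewrite /env_square sw_comult1 1?mulr1; last by mlin.
elim=> {n u} [[|n]|[|n] a u v _ fu _ fv|n x u fu ih] //.
- by rewrite sq1 -[X in X - _]scale1r -scalerBl; apply/env_filZ/env_fil1.
- by rewrite env_square_linear fu fv.
- rewrite env_square_linear scalerDr !scalerA mulrC -scalerA opprD addrACA -scalerBr.
  exact: env_filD.
- have fc : env_fil n (\sw_(a, b <- comult u) ((a * Ugen x - Ugen x * a) * b)).
    rewrite -[n]addn0; apply: (env_fil_comult fu); first by mlin.
    move=> i j a b fa fb; rewrite addn0; apply: env_fil_mul fb.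
    exact: env_fil_commutator.
  rewrite env_square_gen addrAC; apply: env_filA fc.
  rewrite expnS natrM -scalerA -scalerBr scalerAr -mulrBr; apply: env_filZ.
  case: n fu ih => [|n] fu ih; last exact: env_filM.
  by rewrite ih scale1r subrr mulr0; apply: env_fil0.
Qed.

(** * The filtration on the tensor product of U(g) and a vector space *)

Section Primitive.
Variable F : lmodType K.
Local Notation T := (tensor U F).

Inductive ten_fil (n : nat) : T -> Prop :=
| ten_fil0 : ten_fil n 0
| ten_filD u f t : env_fil n u -> ten_fil n t -> ten_fil n (u \ox f + t).

Lemma ten_filA n t t' : ten_fil n t -> ten_fil n t' -> ten_fil n (t + t').
Proof.
elim=> [|u f s fu _ ih] ft'; first by rewrite add0r.
by rewrite -addrA; apply/ten_filD/ih.
Qed.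

Lemma ten_fil_pure n u f : env_fil n u -> ten_fil n (u \ox f).
Proof. by move=> fu; rewrite -[_ \ox _]addr0; apply/ten_filD/ten_fil0. Qed.

Lemma ten_filZ n a t : ten_fil n t -> ten_fil n (a *: t).
Proof.
elim=> [|u f s fu _ ih]; first by rewrite scaler0; apply: ten_fil0.
rewrite scalerDr -(bilinZl (pure_bilin _ _)).
by apply: ten_filA ih; apply/ten_fil_pure/env_filZ.
Qed.

Lemma ten_filW m n t : (m <= n)%N -> ten_fil m t -> ten_fil n t.
Proof.
move=> mn; elim=> [|u f s fu _ ih]; first exact: ten_fil0.
exact/ten_filD/ih/(env_filW mn fu).
Qed.

Lemma ten_fil_exists t : exists n, ten_fil n t.
Proof.
elim/tensor_ind: t => [|u f t [n ft]]; first by exists 0%N; apply: ten_fil0.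
have [m fu] := env_fil_exists u; exists (m + n)%N; apply: ten_filD.
  exact: env_filW (leq_addr _ _) fu.
exact: ten_filW (leq_addl _ _) ft.
Qed.

Let square_bilin : bilin (fun (u : U) (f : F) => env_square u \ox f).
Proof. by have sl := env_square_linear; mlin. Qed.

Lemma ten_square_fil n t : ten_fil n.+1 t ->
  ten_fil n (\sw_(u, f <- t) (env_square u \ox f) - (2 ^ n.+1)%:R *: t).
Proof.
elim=> [|u f s fu _ ih].
  by rewrite (sweedler0 square_bilin) scaler0 subrr; apply: ten_fil0.
rewrite (sweedlerD square_bilin) (sweedler_pure square_bilin) scalerDr opprD addrACA.
apply: ten_filA ih; rewrite -(bilinZl (pure_bilin _ _)) -(linB ((pure_bilin _ _).1 f)).
exact/ten_fil_pure/(env_square_fil fu).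
Qed.

Hypothesis char0 : [pchar K] =i pred0.

(** On a layer [n >= 2] the operator is [2 ^ n] modulo the layer below, so [(2 - 2 ^ n) *: t] lies
    one layer lower, and in characteristic 0 this factor is invertible. *)
Lemma ten_fil_descent t : \sw_(u, f <- t) (env_square u \ox f) = 2%:R *: t -> ten_fil 1 t.
Proof.
move=> et; have [n] := ten_fil_exists t; elim: n => [|[|n] ih] //.
  exact: ten_filW.
move/ten_square_fil; rewrite et -scalerBl => /(ten_filZ (2%:R - (2 ^ n.+2)%:R)^-1).
rewrite scalerA mulVf ?scale1r //.
rewrite subr_eq0 eq_sym -subr_eq0 -natrB; last by rewrite -{1}[2%N]expn1 leq_exp2l.
move/pcharf0P: char0 => ->; rewrite subn_eq0 -{2}[2%N]expn1 leq_exp2l //.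
Qed.

Lemma env_fil0P u : env_fil 0 u -> exists c, u = c%:A.
Proof.
move: {-2}0%N (erefl 0%N) => n + fu.
elim: fu => {n u} [n _|n a u v _ ihu _ ihv n0|//].
  by exists 1; rewrite scale1r.
have [c ->] := ihu n0; have [d ->] := ihv n0.
by exists (a * c + d); rewrite scalerDl scalerA.
Qed.

Lemma env_fil1P u : env_fil 1 u -> exists c x, u = c%:A + Ugen x.
Proof.
move: {-2}1%N (erefl 1%N) => n + fu.
elim: fu => {n u} [n _|n a u v _ ihu _ ihv n1|n x u fu _ [n0]].
- by exists 1, 0; rewrite scale1r (lin0 (@Ugen_linear K g)) addr0.
- have [c [x ->]] := ihu n1; have [d [y ->]] := ihv n1.
  exists (a * c + d), (a *: x + y).
  by rewrite (@Ugen_linear K g) scalerDr scalerA scalerDl addrACA.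
- rewrite n0 in fu; have [c ->] := env_fil0P fu.
  by exists 0, (c *: x); rewrite scale0r add0r -scalerAr mulr1 (linZ (@Ugen_linear K g)).
Qed.

(** Layer one consists of the scalars and g; the counit vanishes on g, so the second hypothesis
    kills the scalar part [f0]. *)
Lemma primitive_tensor t :
  \sw_(u, f <- t) (env_square u \ox f) = 2%:R *: t ->
  \sw_(u, f <- t) (counit u *: f) = 0 ->
  exists t' : tensor g F, t = \sw_(x, f <- t') (Ugen x \ox f).
Proof.
have gl := @Ugen_linear K g.
have gb : bilin (fun (x : g) (f : F) => Ugen x \ox f) by mlin.
have cb : bilin (fun (u : U) (f : F) => counit u *: f) by mlin.
move=> /ten_fil_descent ft et.
have [f0 [t' e]] : exists f0 (t' : tensor g F),
    t = 1 \ox f0 + \sw_(x, f <- t') (Ugen x \ox f).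
  elim: ft {et} => [|u f s /env_fil1P [c [x ->]] _ [f0 [t' ->]]].
    by exists 0, 0; rewrite (bilin0r (pure_bilin _ _)) (sweedler0 gb) addr0.
  exists (c *: f + f0), (x \ox f + t').
  rewrite (sweedlerD gb) (sweedler_pure gb) (bilinDl (pure_bilin _ _)) addrACA.
  by rewrite (bilinDr (pure_bilin _ _)) (bilinZl (pure_bilin _ _)) (bilinZr (pure_bilin _ _)).
exists t'; move: et; rewrite {1}e (sweedlerD cb) (sweedler_pure cb) counit1 scale1r.
rewrite (sweedler_comp _ _ (sweedler_linear cb)).
have -> : \sw_(x, f <- t') \sw_(u, f1 <- Ugen x \ox f) (counit u *: f1) = 0.
  by apply: big1 => p _; rewrite (sweedler_pure cb) Ug_counit_gen scale0r.
by rewrite addr0 e => ->; rewrite (bilin0r (pure_bilin _ _)) add0r.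
Qed.

End Primitive.
End Filtration.

(** * Contractions of threefold tensors *)

(** The pointwise form of [eq_sweedler], for use with [under]. *)
Lemma eq_sw (K : fieldType) (V W : lmodType K) (Z : zmodType) (t : tensor V W)
    (f h : V -> W -> Z) :
  (forall v w, f v w = h v w) -> sweedler t f = sweedler t h.
Proof. exact: eq_sweedler. Qed.

Lemma sw_sum (K : fieldType) (V W Z : lmodType K) (I : Type) (r : seq I) (P : pred I)
    (v : I -> V) (w : I -> W) (k : V -> W -> Z) : bilin k ->
  sweedler (\sum_(i <- r | P i) v i \ox w i) k = \sum_(i <- r | P i) k (v i) (w i).
Proof.
move=> kb; rewrite (lin_sum (sweedler_linear kb)).
by apply: eq_bigr => i _; rewrite (sweedler_pure kb).
Qed.

Section Contraction.
Variables (K : fieldType) (A B C Z : lmodType K) (k : A -> B -> C -> Z).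
Hypotheses (kb : forall c, bilin (fun a b => k a b c)) (kl : forall a b, linear (k a b)).

(** Applied to both sides of an axiom on threefold tensors, such as coassociativity, it yields the
    same identity for any trilinear [k]. *)
Definition sweedler3 (t : tensor (tensor A B) C) : Z :=
  \sw_(p, c <- t) \sw_(a, b <- p) k a b c.

Let body_bilin : bilin (fun p c => \sw_(a, b <- p) k a b c).
Proof. by split=> z; [apply: sweedler_linear|apply: lin_sw_body]. Qed.

Lemma sweedler3_linear : linear sweedler3.
Proof. exact: sweedler_linear body_bilin. Qed.

Lemma sweedler3_pure a b c : sweedler3 (a \ox b \ox c) = k a b c.
Proof. by rewrite /sweedler3 (sweedler_pure body_bilin) (sweedler_pure (kb c)). Qed.

Lemma sweedler3_sw (V W : lmodType K) (t : tensor V W) a b c :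
  sweedler3 (\sw_(v, w <- t) (a v w \ox b v w \ox c v w)) =
  \sw_(v, w <- t) k (a v w) (b v w) (c v w).
Proof.
rewrite (sweedler_comp _ _ sweedler3_linear); apply: eq_sw => v w.
exact: sweedler3_pure.
Qed.

Lemma sweedler3_sw2 (V W V' W' : lmodType K) (t : tensor V W)
    (t' : V -> W -> tensor V' W') a b c :
  sweedler3 (\sw_(v, w <- t) \sw_(v', w' <- t' v w)
    (a v w v' w' \ox b v w v' w' \ox c v w v' w')) =
  \sw_(v, w <- t) \sw_(v', w' <- t' v w) k (a v w v' w') (b v w v' w') (c v w v' w').
Proof.
rewrite (sweedler_comp _ _ sweedler3_linear); apply: eq_sw => v w.
exact: sweedler3_sw.
Qed.

End Contraction.

(** * The structure identity *)

Section StructureIdentity.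
Variables (K : fieldType) (g : finLieAlgType K) (F : comHopfAlgType K).
Variables (act : g -> F -> F) (rho : g -> tensor g F).
Hypotheses (act_b : bilin act) (rho_l : linear rho).

Definition gen_tensor (t : tensor g F) : tensor (Ug g) F :=
  \sw_(x, f <- t) (Ugen x \ox f).

Lemma gen_pure_bilin : bilin (fun (x : g) (f : F) => Ugen x \ox f).
Proof. by have gl := @Ugen_linear K g; mlin. Qed.

Lemma gen_tensor_linear : linear gen_tensor.
Proof. exact: sweedler_linear gen_pure_bilin. Qed.

Lemma sw_gen_tensor (Z : lmodType K) (k : Ug g -> F -> Z) t : bilin k ->
  sweedler (gen_tensor t) k = \sw_(x, f <- t) k (Ugen x) f.
Proof.
move=> kb; rewrite (sweedler_comp _ _ (sweedler_linear kb)).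
by apply: eq_sw => x f; rewrite (sweedler_pure kb).
Qed.

(* The action of x in g on [Ug g \ox F] that multiplication by x on the left
   of U(g) has to induce through the coaction. *)
Definition gen_step (x : g) (t : tensor (Ug g) F) : tensor (Ug g) F :=
  \sw_(x0, x1 <- rho x) \sw_(v, f <- t) ((Ugen x0 * v) \ox (x1 * f)) +
  \sw_(v, f <- t) (v \ox act x f).

Lemma gen_step_bilin : bilin gen_step.
Proof.
have gl := @Ugen_linear K g; rewrite /gen_step; split=> z; last by mlin.
by apply: lin_add; mlin.
Qed.

Lemma sw_gen_step (Z : lmodType K) (k : Ug g -> F -> Z) x t : bilin k ->
  sweedler (gen_step x t) k =
  \sw_(x0, x1 <- rho x) \sw_(v, f <- t) k (Ugen x0 * v) (x1 * f) +
  \sw_(v, f <- t) k v (act x f).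
Proof.
move=> kb; rewrite /gen_step (sweedlerD kb).
rewrite !(sweedler_comp _ _ (sweedler_linear kb)); congr (_ + _); last first.
  by apply: eq_sw => v f; rewrite (sweedler_pure kb).
apply: eq_sw => x0 x1; rewrite (sweedler_comp _ _ (sweedler_linear kb)).
by apply: eq_sw => v f; rewrite (sweedler_pure kb).
Qed.

(* The value that the coaction of U(g) has to take at the product x y of two
   elements of g. *)
Definition gen_mul (x y : g) : tensor (Ug g) F := gen_step x (gen_tensor (rho y)).

Lemma gen_mul_bilin : bilin gen_mul.
Proof.
have gb := gen_step_bilin; have tl := gen_tensor_linear.
by rewrite /gen_mul; split=> z; mlin.
Qed.

Section Basis.
Variables (n : nat) (X : n.-tuple g) (f : 'I_n -> 'I_n -> F).
Hypothesis bX : basis_of fullv X.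
Hypothesis rhoX : forall j : 'I_n, rho X`_j = \sum_(i < n) (X`_i \ox f i j).

(** Since F is commutative, the products of two generators combine into commutators, which leaves a
    tensor linear in g. Equating it with the one of [gen_tensor_bracket], coefficient by
    coefficient, is the structure identity. *)
Lemma gen_mul_bracket (i j : 'I_n) :
  gen_mul X`_i X`_j - gen_mul X`_j X`_i =
  \sum_(k < n) (Ugen X`_k \ox (act X`_i (f k j) - act X`_j (f k i) -
    \sum_(s < n) \sum_(r < n) coord X k (bracket X`_s X`_r) *: (f r i * f s j))).
Proof.
have gl := @Ugen_linear K g.
have pb := @pure_bilin K (Ug g) F.
have mulE (i' j' : 'I_n) : gen_mul X`_i' X`_j' =
    \sum_(s < n) \sum_(r < n) ((Ugen X`_s * Ugen X`_r) \ox (f s i' * f r j')) +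
    \sum_(k < n) (Ugen X`_k \ox act X`_i' (f k j')).
  rewrite /gen_mul /gen_step sw_gen_tensor; last by mlin.
  rewrite !rhoX !sw_sum; try by mlin.
  congr (_ + _); apply: eq_bigr => s _.
  by rewrite sw_gen_tensor ?sw_sum //; mlin.
rewrite !mulE opprD addrACA; under [RHS]eq_bigr do rewrite !(linB (pb.2 _)).
rewrite [RHS]sumrB -[X in _ + X]sumrB [LHS]addrC; congr (_ + _).
rewrite -[LHS]opprB; congr (- _).
rewrite [X in _ - X]exchange_big /=; under [RHS]eq_bigr do rewrite (lin_sum (pb.2 _)).
rewrite [RHS]exchange_big -sumrB; apply: eq_bigr => s _ /=.
under [RHS]eq_bigr do rewrite (lin_sum (pb.2 _)).
rewrite [RHS]exchange_big -sumrB; apply: eq_bigr => r _ /=.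
rewrite (mulrC (f s j)) -(linB (pb.1 _)) -Ugen_bracket.
rewrite [in LHS](coord_basis bX (memvf (bracket X`_s X`_r))).
rewrite (lin_sum gl) (lin_sum (pb.1 _)); apply: eq_bigr => k _.
by rewrite (linZ gl) (bilinZl pb) (bilinZr pb).
Qed.

Lemma gen_tensor_bracket (i j : 'I_n) :
  gen_tensor (rho (bracket X`_i X`_j)) =
  \sum_(k < n) (Ugen X`_k \ox \sum_(l < n) coord X l (bracket X`_i X`_j) *: f k l).
Proof.
have pb := @pure_bilin K (Ug g) F.
rewrite [in LHS](coord_basis bX (memvf (bracket X`_i X`_j))).
rewrite (lin_sum rho_l) (lin_sum gen_tensor_linear).
under [RHS]eq_bigr do rewrite (lin_sum (pb.2 _)).
rewrite exchange_big; apply: eq_bigr => l _ /=.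
rewrite (linZ rho_l) (linZ gen_tensor_linear) rhoX /gen_tensor (sw_sum _ _ _ _ gen_pure_bilin).
by rewrite scaler_sumr; apply: eq_bigr => k _; rewrite (bilinZr pb).
Qed.

Lemma pure_basis_inj (a b : 'I_n -> F) :
  \sum_(k < n) (X`_k \ox a k) = \sum_(k < n) (X`_k \ox b k) -> a =1 b.
Proof.
move=> e k.
have cb : bilin (fun (v : g) (c : F) => coord X k v *: c).
  split=> z; last exact: linear_scale.
  by apply: lin_scalel => c x y; rewrite linearP.
have := congr1 (fun t => sweedler t (fun v c => coord X k v *: c)) e.
have coefE (h : 'I_n -> F) : sweedler (\sum_(k < n) (X`_k \ox h k))
    (fun v c => coord X k v *: c) = h k.
  rewrite (sw_sum _ _ _ _ cb) (bigD1 k) //= big1 => [|l /negbTE nl].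
    by rewrite coord_free ?(basis_free bX) // eqxx scale1r addr0.
  by rewrite coord_free ?(basis_free bX) // nl scale0r.
by rewrite !coefE.
Qed.

End Basis.
End StructureIdentity.

(** * The extended coaction on products with a generator *)

Section ExtendedCoaction.
Variables (K : fieldType) (g : finLieAlgType K) (F : comHopfAlgType K).
Variables (Act : Ug g -> F -> F) (Rho : Ug g -> tensor (Ug g) F).
Variables (act : g -> F -> F) (rho : g -> tensor g F).
Hypotheses (Act_mod : left_module Act) (Rho_l : linear Rho).
Hypotheses (Rho_gen : coact_on_gen rho Rho) (Rho1 : Rho 1 = 1 \ox 1).
Hypotheses (RhoM : coact_mul Act Rho) (Act_gen : forall x f, Act (Ugen x) f = act x f).
Let Act_b : bilin Act := act_bilin Act_mod.

Lemma coact_Ugen x : Rho (Ugen x) = gen_tensor (rho x).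
Proof. exact: Rho_gen. Qed.

(** [x] is primitive and [Rho 1 = 1 \ox 1], so the two terms of its coproduct give the two terms of
    [gen_step]. *)
Lemma coact_Ugen_mul x v : Rho (Ugen x * v) = gen_step act rho x (Rho v).
Proof.
rewrite RhoM Ug_comult_gen sweedlerD; last by mlin.
rewrite !sweedler_pure; try by mlin.
rewrite Rho1 sweedler_pure; last by mlin.
rewrite coact_Ugen sw_gen_tensor; last by mlin.
congr (_ + _).
  apply: eq_sw => x0 x1; apply: eq_sw => v0 v1.
  by rewrite (act_1 Act_mod).
by apply: eq_sw => v0 v1; rewrite !mul1r Act_gen.
Qed.

Lemma coact_gen_mul x y : Rho (Ugen x * Ugen y) = gen_mul act rho x y.
Proof. by rewrite coact_Ugen_mul coact_Ugen. Qed.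

End ExtendedCoaction.

(** * From matched pairs to g-Hopf algebras *)

Section Restriction.
Variables (K : fieldType) (g : finLieAlgType K) (F : comHopfAlgType K).
Variables (Act : Ug g -> F -> F) (Rho : Ug g -> tensor (Ug g) F).
Hypothesis char0 : [pchar K] =i pred0.
Hypothesis mp : matched_pair Act Rho.

Let gl := @Ugen_linear K g.
Let Act_b : bilin Act := act_bilin (mp_module mp).
Let Rho_l : linear Rho := coact_linear (mp_comodule mp).
Let rl := @env_retract_linear K g.

Let retract_bilin : bilin (fun (u : Ug g) (f : F) => env_retract u \ox f).
Proof. by mlin. Qed.

Definition restr_act (x : g) (f : F) : F := Act (Ugen x) f.
(** The retraction makes sense of the restriction for any [Rho]; [matched_coact_Ugen] shows that a
    matched pair loses nothing by it. *)
Definition restr_coact (x : g) : tensor g F :=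
  \sw_(u, f <- Rho (Ugen x)) (env_retract u \ox f).

Lemma restr_coact_linear : linear restr_coact.
Proof. by rewrite /restr_coact; mlin. Qed.

Lemma restr_act_bilin : bilin restr_act.
Proof. by rewrite /restr_act; mlin. Qed.

Lemma gen_tensorK (t : tensor g F) :
  \sw_(u, f <- gen_tensor t) (env_retract u \ox f) = t.
Proof.
rewrite sw_gen_tensor // [RHS]tensorE; apply: eq_sw => x f.
by rewrite [env_retract _]env_genK.
Qed.

(** Multiplying the two U(g)-factors in the comodule coalgebra axiom at the primitive element [x]
    gives [env_square] on one side and twice the coaction on the other, so that [primitive_tensor]
    applies. *)
Lemma matched_coact_Ugen x : Rho (Ugen x) = gen_tensor (restr_coact x).
Proof.
suff [t e] : exists t : tensor g F, Rho (Ugen x) = gen_tensor t.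
  by rewrite e /restr_coact e gen_tensorK.
apply: (primitive_tensor char0); last first.
  by rewrite (mp_comodule_counit mp) Ug_counit_gen scale0r.
have := congr1 (sweedler3 (fun (a b : Ug g) (c : F) => (a * b) \ox c))
  (mp_comodule_coalg mp (Ugen x)).
rewrite sweedler3_sw2; try by move=> *; mlin.
rewrite Ug_comult_gen sweedlerD; last by mlin.
rewrite !sweedler_pure; try by mlin.
have tl : linear (sweedler3 (fun (a b : Ug g) (c : F) => (a * b) \ox c)).
  by apply: sweedler3_linear => *; mlin.
rewrite (linD tl) !sweedler3_sw2; try by move=> *; mlin.
rewrite (mp_coact1 mp) sweedler_pure; last by mlin.
move=> e; transitivity (\sw_(v, w <- Rho (Ugen x)) \sw_(v', w' <- comult v) ((v' * w') \ox w)).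
  by apply: eq_sw => v w; rewrite /env_square (sweedler_comp _ _ ((pure_bilin _ _).1 w)).
rewrite e scaler_nat mulr2n [in RHS](tensorE (Rho (Ugen x))).
congr (_ + _); apply: eq_sw => v w; last by rewrite !mul1r.
by rewrite sweedler_pure ?mulr1 //; mlin.
Qed.

Lemma restr_coactA x :
  \sw_(v0, v1 <- restr_coact x) \sw_(v00, v01 <- restr_coact v0) (v00 \ox v01 \ox v1) =
  \sw_(v0, v1 <- restr_coact x) \sw_(f1, f2 <- comult v1) (v0 \ox f1 \ox f2).
Proof.
have := congr1 (sweedler3 (fun (a : Ug g) (b c : F) => env_retract a \ox b \ox c))
  (coactA (mp_comodule mp) (Ugen x)).
rewrite !sweedler3_sw2; try by move=> *; mlin.
rewrite matched_coact_Ugen !sw_gen_tensor; try by mlin.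
move=> e; etransitivity; last (etransitivity; first exact: e).
  apply: eq_sw => y f; rewrite matched_coact_Ugen sw_gen_tensor; last by mlin.
  by apply: eq_sw => z f'; rewrite [env_retract _]env_genK.
by apply: eq_sw => y f; rewrite [env_retract _]env_genK.
Qed.

Lemma restr_coact_counit x : \sw_(v0, v1 <- restr_coact x) (counit v1 *: v0) = x.
Proof.
have := congr1 (@env_retract K g) (coact_counit (mp_comodule mp) (Ugen x)).
rewrite [env_retract (Ugen x)]env_genK => {2}<-.
rewrite matched_coact_Ugen sw_gen_tensor; last by mlin.
rewrite (sweedler_comp _ _ rl); apply: eq_sw => y f.
by rewrite (linZ rl) [env_retract _]env_genK.
Qed.

Lemma restr_act_der x f h :
  restr_act x (f * h) = restr_act x f * h + f * restr_act x h.
Proof.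
rewrite /restr_act (mp_module_algM mp) Ug_comult_gen sweedlerD; last by mlin.
by rewrite !sweedler_pure ?(act_1 (mp_module mp)) //; mlin.
Qed.

Lemma restr_act_bracket x y f : restr_act (bracket x y) f =
  restr_act x (restr_act y f) - restr_act y (restr_act x f).
Proof.
by rewrite /restr_act Ugen_bracket (linB (Act_b.1 f)) !(act_M (mp_module mp)).
Qed.

Lemma restr_act_comult x f :
  comult (restr_act x f) = \sw_(f1, f2 <- comult f)
    (\sw_(x0, x1 <- restr_coact x) (restr_act x0 f1 \ox (x1 * f2)) + f1 \ox restr_act x f2).
Proof.
rewrite /restr_act (mp_comult mp) Ug_comult_gen sweedlerD; last by mlin.
rewrite !sweedler_pure; try by mlin.
rewrite (mp_coact1 mp) sweedler_pure; last by mlin.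
rewrite sweedler_add [in RHS]sweedler_exchange; congr (_ + _).
  rewrite [Rho _]matched_coact_Ugen sw_gen_tensor; last by mlin.
  apply: eq_sw => y h; apply: eq_sw => f1 f2.
  by rewrite (act_1 (mp_module mp)).
by apply: eq_sw => f1 f2; rewrite (act_1 (mp_module mp)) mul1r.
Qed.

(** The identity comes from applying [Rho] to the relation [[x, y] = x y - y x] of U(g), with
    [gen_mul] as the value on products. *)
Lemma restr_structure : structure_identity restr_act restr_coact.
Proof.
move=> n X f bX rhoX i j.
have gm (x y : g) : gen_mul restr_act restr_coact x y = Rho (Ugen x * Ugen y).
  symmetry; apply: coact_gen_mul (mp_module mp) Rho_l _ (mp_coact1 mp) (mp_coactM mp) _ _ _ => //.
  exact: matched_coact_Ugen.
have := gen_mul_bracket restr_act_bilin bX rhoX i j.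
rewrite !gm -(linB Rho_l) -Ugen_bracket matched_coact_Ugen.
rewrite (gen_tensor_bracket restr_coact_linear bX rhoX) => e k.
(* Retracting U(g) onto g allows coefficients in the basis to be compared. *)
have {e} := congr1 (fun t => \sw_(u, f <- t) (env_retract u \ox f)) e.
rewrite !sw_sum //; under eq_bigr do rewrite [env_retract _]env_genK.
under [X in _ = X -> _]eq_bigr do rewrite [env_retract _]env_genK.
by move/(pure_basis_inj bX)/(_ k) => ->; rewrite [RHS]addrC subrK.
Qed.

Lemma matched_pair_g_Hopf : g_Hopf restr_act restr_coact.
Proof.
split.
- split; [exact: restr_act_bilin|exact: restr_act_bracket|exact: restr_act_der].
- split; [exact: restr_coact_linear|exact: restr_coactA|exact: restr_coact_counit].
- exact: restr_structure.
- by move=> x f; rewrite (mp_counit mp) Ug_counit_gen mul0r.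
- exact: restr_act_comult.
Qed.

End Restriction.

(** * From g-Hopf algebras to matched pairs *)

Lemma Ug_word_ext (K : fieldType) (g : lieAlgType K) (Z : lmodType K) (L R : Ug g -> Z) :
  linear L -> linear R -> L 1 = R 1 ->
  (forall x u, L u = R u -> L (Ugen x * u) = R (Ugen x * u)) -> L =1 R.
Proof.
move=> Ll Rl e1 ex; apply: Ug_word_ind => // a u v eu ev.
by rewrite Ll Rl eu ev.
Qed.

(** * Extending the action and the coaction to U(g) *)

Section Extension.
Variables (K : fieldType) (g : finLieAlgType K) (F : comHopfAlgType K).
Variables (act : g -> F -> F) (rho : g -> tensor g F).
Hypothesis gH : g_Hopf act rho.
Let act_b : bilin act := lact_bilin (gH_act gH).
Let rho_l : linear rho := coact_linear (gH_coact gH).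
Let actM := lact_der (gH_act gH).
Let gl := @Ugen_linear K g.
Let step_b := gen_step_bilin act_b rho_l.

Lemma derivation1 x : act x 1 = 0.
Proof.
by apply: (addrI (act x 1)); rewrite addr0 -{3}[1]mulr1 actM mulr1 mul1r.
Qed.

(** Both sides are bilinear, and on a basis this is the structure identity for the coefficients
    supplied by [coaction_coefP]. *)
Lemma gen_mul_commutator x y :
  gen_mul act rho x y - gen_mul act rho y x = gen_tensor (rho (bracket x y)).
Proof.
pose n := \dim (fullv : {vspace g}); pose X : n.-tuple g := vbasis fullv.
have bX : basis_of fullv X by apply: vbasisP.
pose f (i j : 'I_n) := \sw_(v, c <- rho X`_j) (coord X i v *: c).
have rhoX (j : 'I_n) : rho X`_j = \sum_(i < n) (X`_i \ox f i j) := coaction_coefP _ bX.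
have mb := gen_mul_bilin act_b rho_l; have bb := @bracket_bilin K g.
have tl := @gen_tensor_linear K g F.
have basis (i j : 'I_n) : gen_mul act rho X`_i X`_j - gen_mul act rho X`_j X`_i =
    gen_tensor (rho (bracket X`_i X`_j)).
  rewrite (gen_mul_bracket act_b bX rhoX) (gen_tensor_bracket rho_l bX rhoX).
  apply: eq_bigr => k _; congr (_ \ox _).
  by rewrite (gH_structure gH bX rhoX) [X in X - _]addrC addrK.
have Ll z : linear (fun x => gen_mul act rho x z - gen_mul act rho z x) by mlin.
have Lr z : linear (fun x => gen_mul act rho z x - gen_mul act rho x z) by mlin.
have Rl z : linear (fun x => gen_tensor (rho (bracket x z))) by mlin.
have Rr z : linear (fun x => gen_tensor (rho (bracket z x))) by mlin.
rewrite (coord_basis bX (memvf x)) (lin_sum (Ll y)) (lin_sum (Rl y)).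
apply: eq_bigr => i _; rewrite (linZ (Ll y)) (linZ (Rl y)); congr (_ *: _).
rewrite (coord_basis bX (memvf y)) (lin_sum (Lr _)) (lin_sum (Rr _)).
by apply: eq_bigr => j _; rewrite (linZ (Lr _)) (linZ (Rr _)) basis.
Qed.

Lemma gen_step_pure x v f : gen_step act rho x (v \ox f) =
  \sw_(u, h <- gen_tensor (rho x)) ((u * v) \ox (h * f)) + v \ox act x f.
Proof.
rewrite /gen_step sw_gen_tensor; last by mlin.
rewrite [X in _ + X]sweedler_pure; last by mlin.
by congr (_ + _); apply: eq_sw => x0 x1; rewrite sweedler_pure //; mlin.
Qed.

(** Isolates the two mixed terms, whose sum is symmetric in [x] and [y] and so cancels in a
    commutator. *)
Lemma gen_step2_pure x y v f : gen_step act rho x (gen_step act rho y (v \ox f)) =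
  \sw_(u, h <- gen_mul act rho x y) ((u * v) \ox (h * f)) +
  (\sw_(y0, y1 <- rho y) ((Ugen y0 * v) \ox (y1 * act x f)) +
   \sw_(x0, x1 <- rho x) ((Ugen x0 * v) \ox (x1 * act y f))) + v \ox act x (act y f).
Proof.
have kb : bilin (fun (u : Ug g) (h : F) => (u * v) \ox (h * f)) by mlin.
rewrite gen_step_pure (linD (step_b.2 x)) gen_step_pure !addrA; congr (_ + _).
rewrite !sw_gen_tensor; try by mlin.
congr (_ + _); rewrite (sweedler_comp _ _ (step_b.2 x)).
rewrite /gen_mul (sw_gen_step _ _ _ _ kb).
under eq_sw => y0 y1.
  rewrite gen_step_pure sw_gen_tensor; last by mlin.
  rewrite actM (bilinDr (pure_bilin _ _)) addrA; over.
rewrite !sweedler_add [in RHS]sweedler_exchange !sw_gen_tensor; try by mlin.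
congr (_ + _ + _); apply: eq_sw => y0 y1; apply: eq_sw => x0 x1.
by rewrite !mulrA.
Qed.

(** On pure tensors the mixed terms of [gen_step2_pure] cancel; [gen_mul_commutator] accounts for
    the first terms and the Lie action of g on F for the last ones. *)
Lemma gen_step_bracket x y t : gen_step act rho (bracket x y) t =
  gen_step act rho x (gen_step act rho y t) - gen_step act rho y (gen_step act rho x t).
Proof.
move: t; apply: tensor_ext; [by mlin|by mlin|move=> v f].
rewrite gen_step_pure !gen_step2_pure -gen_mul_commutator.
have kl : linear (fun t => \sw_(u, h <- t) ((u * v) \ox (h * f) : tensor (Ug g) F)) by mlin.
rewrite (linB kl) (lact_bracket (gH_act gH)) (linB ((pure_bilin _ _).2 v)).
set A := sweedler (gen_mul _ _ x y) _; set A' := sweedler (gen_mul _ _ y x) _.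
set B := sweedler (rho y) _; set C := sweedler (rho x) _.
rewrite [C + B]addrC [A + (B + C) + _]addrAC [A' + (B + C) + _]addrAC.
by rewrite [A' + _ + (B + C)]addrC addrKA opprD [RHS]addrACA.
Qed.

Definition ext_action : Ug g -> F -> F := env_act act.
Definition ext_step : Ug g -> tensor (Ug g) F -> tensor (Ug g) F :=
  env_act (gen_step act rho).
Definition ext_coaction (u : Ug g) : tensor (Ug g) F := ext_step u (1 \ox 1).

(** Here [env_act] is taken with [S] always true. *)
Let any_linear (M : lmodType K) : forall (a : K) (m m' : M), True -> True -> True.
Proof. by []. Qed.
Let any_closed (M : lmodType K) : g -> M -> True -> True.
Proof. by []. Qed.
Let act_bracket x y f (_ : True) := lact_bracket (gH_act gH) x y f.
Let step_bracket x y t (_ : True) := gen_step_bracket x y t.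

Lemma ext_action_module : left_module ext_action.
Proof.
split.
- split=> [f|u]; last exact: (env_act_linearr act_b).
  exact: (env_act_linearl (@any_linear F) (@any_closed F) act_b act_bracket).
- by move=> f; apply: (env_act1 (@any_linear F) (@any_closed F) act_b act_bracket).
- by move=> u v f; apply: (env_actM (@any_linear F) (@any_closed F) act_b act_bracket).
Qed.

Lemma ext_action_gen x f : ext_action (Ugen x) f = act x f.
Proof. exact: (env_act_gen (@any_linear F) (@any_closed F) act_b act_bracket). Qed.

Let T := tensor (Ug g) F.
Lemma ext_step_module : left_module ext_step.
Proof.
split.
- split=> [f|u]; last exact: (env_act_linearr step_b).
  exact: (env_act_linearl (@any_linear T) (@any_closed T) step_b step_bracket).
- by move=> f; apply: (env_act1 (@any_linear T) (@any_closed T) step_b step_bracket).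
- by move=> u v f; apply: (env_actM (@any_linear T) (@any_closed T) step_b step_bracket).
Qed.

Lemma ext_step_gen x t : ext_step (Ugen x) t = gen_step act rho x t.
Proof. exact: (env_act_gen (@any_linear T) (@any_closed T) step_b step_bracket). Qed.

Let Act_b := act_bilin ext_action_module.
Let Step_b := act_bilin ext_step_module.

Lemma ext_coaction_linear : linear ext_coaction.
Proof. by rewrite /ext_coaction; mlin. Qed.
Let Rho_l := ext_coaction_linear.

Lemma ext_coaction1 : ext_coaction 1 = 1 \ox 1.
Proof. exact: act_1 ext_step_module _. Qed.

Lemma ext_coaction_gen : coact_on_gen rho ext_coaction.
Proof.
move=> x; rewrite /ext_coaction ext_step_gen gen_step_pure derivation1.
rewrite (bilin0r (pure_bilin _ _)) addr0 sw_gen_tensor; last by mlin.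
by apply: eq_sw => x0 x1; rewrite !mulr1.
Qed.

Lemma ext_coaction_mulgen x u :
  ext_coaction (Ugen x * u) = gen_step act rho x (ext_coaction u).
Proof. by rewrite /ext_coaction (act_M ext_step_module) ext_step_gen. Qed.

(** The product rule for the coaction, one pure tensor at a time. The induction on [u] works because
    generators act on F by derivations. *)
Lemma ext_step_pure u v f : ext_step u (v \ox f) =
  \sw_(u1, u2 <- comult u) \sw_(u10, u11 <- ext_coaction u1)
    ((u10 * v) \ox (u11 * ext_action u2 f)).
Proof.
move: u; apply: Ug_word_ext; [by mlin|by mlin| |move=> x u ih].
  rewrite (act_1 ext_step_module) sw_comult1; last by mlin.
  rewrite ext_coaction1 sweedler_pure; last by mlin.
  by rewrite (act_1 ext_action_module) !mul1r.
rewrite (act_M ext_step_module) ext_step_gen ih sw_comult_Ugen; last by mlin.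
rewrite (sweedler_comp _ _ (step_b.2 x)); apply: eq_sw => u1 u2.
rewrite ext_coaction_mulgen sw_gen_step; last by mlin.
rewrite (sweedler_comp _ _ (step_b.2 x)).
rewrite sweedler_exchange -!sweedler_add; apply: eq_sw => u10 u11.
rewrite gen_step_pure sw_gen_tensor; last by mlin.
rewrite (act_M ext_action_module) ext_action_gen actM (bilinDr (pure_bilin _ _)) addrA.
by congr (_ + _ + _); apply: eq_sw => x0 x1; rewrite !mulrA.
Qed.

(** Acting by [u * v] on [1 \ox 1] is acting by [u] on the coaction of [v], and [ext_step_pure]
    applies to each term of the latter. *)
Lemma ext_coactionM : coact_mul ext_action ext_coaction.
Proof.
move=> u v; rewrite {1}/ext_coaction (act_M ext_step_module) -/(ext_coaction v).
rewrite {1}(tensorE (ext_coaction v)) (sweedler_comp _ _ (Step_b.2 u)).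
under eq_sw do rewrite ext_step_pure.
rewrite sweedler_exchange; apply: eq_sw => u1 u2.
by rewrite sweedler_exchange.
Qed.

Lemma ext_exists : extends_to_Ug act rho ext_action ext_coaction.
Proof.
split.
- exact: ext_action_module.
- exact: ext_action_gen.
- exact: ext_coaction_linear.
- exact: ext_coaction_gen.
- exact: ext_coaction1.
- exact: ext_coactionM.
Qed.

End Extension.

Lemma sweedler3_sw3 (K : fieldType) (A B C Z V W V' W' V2 W2 : lmodType K)
    (k : A -> B -> C -> Z) (t : tensor V W) (t' : V -> W -> tensor V' W')
    (t2 : V -> W -> V' -> W' -> tensor V2 W2) a b c :
  (forall c, bilin (fun a b => k a b c)) -> (forall a b, linear (k a b)) ->
  sweedler3 k (\sw_(v, w <- t) \sw_(v', w' <- t' v w) \sw_(v2, w2 <- t2 v w v' w')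
    (a v w v' w' v2 w2 \ox b v w v' w' v2 w2 \ox c v w v' w' v2 w2)) =
  \sw_(v, w <- t) \sw_(v', w' <- t' v w) \sw_(v2, w2 <- t2 v w v' w')
    k (a v w v' w' v2 w2) (b v w v' w' v2 w2) (c v w v' w' v2 w2).
Proof.
move=> kb kl; rewrite (sweedler_comp _ _ (sweedler3_linear kb kl)); apply: eq_sw => v w.
exact: sweedler3_sw2.
Qed.

(** * The matched pair axioms for an extension to U(g) *)

Section MatchedPair.
Variables (K : fieldType) (g : finLieAlgType K) (F : comHopfAlgType K).
Variables (act : g -> F -> F) (rho : g -> tensor g F).
Variables (Act : Ug g -> F -> F) (Rho : Ug g -> tensor (Ug g) F).
Hypothesis gH : g_Hopf act rho.
Hypothesis ext : extends_to_Ug act rho Act Rho.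
Let act_b : bilin act := lact_bilin (gH_act gH).
Let rho_l : linear rho := coact_linear (gH_coact gH).
Let actD := lact_der (gH_act gH).
Let gl := @Ugen_linear K g.
Let Act_mod := ext_module ext.
Let Act_b : bilin Act := act_bilin Act_mod.
Let Rho_l : linear Rho := ext_coact_linear ext.
Let Rho1 := ext_coact1 ext.
Let Act1 := act_1 Act_mod.

Let ActM x u f : Act (Ugen x * u) f = act x (Act u f).
Proof. by rewrite (act_M Act_mod) (ext_act ext). Qed.

Let swRho1 (Z : lmodType K) (k : Ug g -> F -> Z) : bilin k -> sweedler (Rho 1) k = k 1 1.
Proof. by move=> kb; rewrite Rho1 sweedler_pure. Qed.

Let swRhoM (Z : lmodType K) (k : Ug g -> F -> Z) x u : bilin k ->
  sweedler (Rho (Ugen x * u)) k =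
  \sw_(x0, x1 <- rho x) \sw_(v, f <- Rho u) k (Ugen x0 * v) (x1 * f) +
  \sw_(v, f <- Rho u) k v (act x f).
Proof.
move=> kb.
rewrite (coact_Ugen_mul Act_mod Rho_l (ext_coact ext) Rho1 (ext_coactM ext) (ext_act ext)).
exact: sw_gen_step.
Qed.

Lemma ext_module_alg1 u : Act u 1 = (counit u)%:A.
Proof.
move: u; apply: Ug_word_ext; [by mlin|by mlin| |move=> x u ih].
  by rewrite Act1 counit1 scale1r.
by rewrite ActM ih (bilinZr act_b) (derivation1 gH) scaler0 counit_Ugen scale0r.
Qed.

Lemma ext_module_algM u f h : Act u (f * h) = \sw_(u1, u2 <- comult u) (Act u1 f * Act u2 h).
Proof.
move: u; apply: Ug_word_ext; [by mlin|by mlin| |move=> x u ih].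
  by rewrite sw_comult1 ?Act1 //; mlin.
rewrite ActM ih sw_comult_Ugen; last by mlin.
rewrite (sweedler_comp _ _ (act_b.2 x)); apply: eq_sw => u1 u2.
by rewrite actD !ActM.
Qed.

Lemma sw_comult_act (Z : lmodType K) (k : F -> F -> Z) x f : bilin k ->
  sweedler (comult (act x f)) k = \sw_(f1, f2 <- comult f)
    (\sw_(x0, x1 <- rho x) k (act x0 f1) (x1 * f2) + k f1 (act x f2)).
Proof.
move=> kb; rewrite (gH_comult gH) (sweedler_comp _ _ (sweedler_linear kb)).
apply: eq_sw => f1 f2; rewrite (sweedlerD kb) (sweedler_pure kb); congr (_ + _).
rewrite (sweedler_comp _ _ (sweedler_linear kb)); apply: eq_sw => x0 x1.
exact: sweedler_pure.
Qed.

Lemma ext_coactA u :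
  \sw_(v0, v1 <- Rho u) \sw_(v00, v01 <- Rho v0) (v00 \ox v01 \ox v1) =
  \sw_(v0, v1 <- Rho u) \sw_(f1, f2 <- comult v1) (v0 \ox f1 \ox f2).
Proof.
move: u; apply: Ug_word_ext; [by mlin|by mlin| |move=> x u ih].
  rewrite !swRho1; try by mlin.
  by rewrite comult1 sweedler_pure //; mlin.
(* The operator that takes both sides at [u] to those at [Ugen x * u]. For the term in which [x]
   spreads over all three factors this is coassociativity of [rho]; the other two come from the
   coproduct of [act x f]. *)
pose k (a : Ug g) (b c : F) : tensor (tensor (Ug g) F) F :=
  \sw_(x0, x1 <- rho x) \sw_(x00, x01 <- rho x0)
    ((Ugen x00 * a) \ox (x01 * b) \ox (x1 * c)) +
  \sw_(x0, x1 <- rho x) (a \ox act x0 b \ox (x1 * c)) + a \ox b \ox act x c.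
have kb c : bilin (fun a b => k a b c) by rewrite /k; mlin.
have kl a b : linear (k a b) by rewrite /k; mlin.
have gen3 h : bilin (fun (a : Ug g) (b : F) => a \ox b \ox (h : F)) by mlin.
have := congr1 (sweedler3 k) ih; rewrite !sweedler3_sw2 // => e.
rewrite !swRhoM; try by mlin.
etransitivity; last (etransitivity; first exact: e).
- rewrite sweedler_exchange -sweedler_add; apply: eq_sw => v f.
  rewrite /k !sweedler_add; congr (_ + _).
  under eq_sw => x0 x1 do rewrite (swRhoM _ _ (gen3 _)).
  rewrite sweedler_add; congr (_ + _); last exact: sweedler_exchange.
  rewrite [RHS]sweedler_exchange; apply: eq_sw => x0 x1.
  exact: sweedler_exchange.
- rewrite [X in _ = X + _]sweedler_exchange -sweedler_add; apply: eq_sw => v f.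
  rewrite sw_comult_act; last by mlin.
  rewrite /k !sweedler_add addrA; congr (_ + _ + _).
  under [X in _ = X]eq_sw => x0 x1.
    rewrite comultM sweedler_tmul; last by mlin.
    rewrite sweedler_exchange; over.
  rewrite [RHS]sweedler_exchange; apply: eq_sw => f1 f2.
  have := congr1 (sweedler3 (fun (a : g) (b c : F) => (Ugen a * v) \ox (b * f1) \ox (c * f2)))
    (coactA (gH_coact gH) x).
  by rewrite !sweedler3_sw2 // => *; mlin.
Qed.

Lemma ext_coact_counit u : \sw_(u0, u1 <- Rho u) (counit u1 *: u0) = u.
Proof.
move: u; apply: Ug_word_ext; [by mlin|by mlin| |move=> x u ih].
  by rewrite swRho1 ?counit1 ?scale1r //; mlin.
rewrite swRhoM; last by mlin.
under [X in _ + X]eq_sw do rewrite (gH_counit gH) scale0r.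
rewrite [X in _ + X]big1 // addr0 -{2}ih.
rewrite sweedler_exchange (sweedler_comp _ _ (linear_mul (Ugen x))).
apply: eq_sw => v f.
have hl : linear (fun y => Ugen y * (counit f *: v)) by mlin.
rewrite -[in RHS](coact_counit (gH_coact gH) x) (sweedler_comp _ _ hl).
by apply: eq_sw => x0 x1; rewrite counitM (linZ hl) -scalerAr scalerA.
Qed.

Lemma ext_comodule_coalg u :
  \sw_(u0, u1 <- Rho u) \sw_(u01, u02 <- comult u0) (u01 \ox u02 \ox u1) =
  \sw_(u1, u2 <- comult u) \sw_(u10, u11 <- Rho u1) \sw_(u20, u21 <- Rho u2)
    (u10 \ox u20 \ox (u11 * u21)).
Proof.
move: u; apply: Ug_word_ext; [by mlin|by mlin| |move=> x u ih].
  rewrite swRho1; last by mlin.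
  rewrite !sw_comult1; try by mlin.
  by rewrite !swRho1 ?mulr1 //; mlin.
(* The left side produces this operator because [x] is primitive, the right side because [x] acts on
   F by derivations and F is commutative. *)
pose k (a b : Ug g) (c : F) : tensor (tensor (Ug g) (Ug g)) F :=
  \sw_(x0, x1 <- rho x) ((Ugen x0 * a) \ox b \ox (x1 * c)) +
  \sw_(x0, x1 <- rho x) (a \ox (Ugen x0 * b) \ox (x1 * c)) + a \ox b \ox act x c.
have kb c : bilin (fun a b => k a b c) by rewrite /k; mlin.
have kl a b : linear (k a b) by rewrite /k; mlin.
have := congr1 (sweedler3 k) ih; rewrite sweedler3_sw2 // sweedler3_sw3 // => e.
etransitivity; last (etransitivity; first exact: e).
- rewrite swRhoM; last by mlin.
  rewrite sweedler_exchange -sweedler_add; apply: eq_sw => v f.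
  rewrite /k [RHS]sweedler_add; congr (_ + _).
  rewrite sweedler_add [X in _ = X + _]sweedler_exchange [X in _ = _ + X]sweedler_exchange.
  rewrite -sweedler_add; apply: eq_sw => x0 x1.
  by rewrite sw_comult_Ugen ?sweedler_add //; mlin.
- rewrite sw_comult_Ugen; last by mlin.
  apply: eq_sw => u1 u2; rewrite swRhoM; last by mlin.
  rewrite [X in _ = X + _ + _]sweedler_exchange -!sweedler_add; apply: eq_sw => u10 u11.
  rewrite swRhoM; last by mlin.
  rewrite [X in _ = X + _ + _]sweedler_exchange [X in _ = _ + (X + _)]sweedler_exchange.
  rewrite -!sweedler_add; apply: eq_sw => u20 u21.
  rewrite /k actD (linD (linear_pure _)) addrACA; congr (_ + _ + (_ + _)).
    by apply: eq_sw => x0 x1; rewrite mulrA.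
  by apply: eq_sw => x0 x1; rewrite mulrCA.
Qed.

Lemma ext_comodule_counit u : \sw_(u0, u1 <- Rho u) (counit u0 *: u1) = (counit u)%:A.
Proof.
move: u; apply: Ug_word_ext; [by mlin|by mlin| |move=> x u ih].
  by rewrite swRho1 //; mlin.
rewrite swRhoM; last by mlin.
rewrite counit_Ugen scale0r.
rewrite [X in X + _]big1 ?add0r => [|p _]; last first.
  by apply: big1 => q _; rewrite counit_Ugen scale0r.
under eq_sw do rewrite -(bilinZr act_b).
rewrite -(sweedler_comp _ _ (act_b.2 x)) ih.
by rewrite (bilinZr act_b) (derivation1 gH) scaler0.
Qed.

Lemma ext_counit u f : counit (Act u f) = counit u * counit f.
Proof.
elim/Ug_word_ind: u => [|a u v ihu ihv|x u ih].
- by rewrite Act1 counit1 mul1r.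
- by rewrite Act_b.1 !counit_linear ihu ihv mulrDl mulrA.
- by rewrite ActM (gH_counit gH) counit_Ugen mul0r.
Qed.

Lemma ext_comult u f : comult (Act u f) =
  \sw_(u1, u2 <- comult u) \sw_(u10, u11 <- Rho u1) \sw_(f1, f2 <- comult f)
    (Act u10 f1 \ox (u11 * Act u2 f2)).
Proof.
move: u; apply: Ug_word_ext; [by mlin|by mlin| |move=> x u ih].
  rewrite sw_comult1; last by mlin.
  rewrite swRho1; last by mlin.
  rewrite Act1 [LHS]tensorE; apply: eq_sw => f1 f2.
  by rewrite !Act1 mul1r.
rewrite ActM (gH_comult gH) ih.
(* This is the bullet action of [x] on pairs, through which [gH_comult] expresses the coproduct of
   [act x f]; the right side at [u] is carried by it to the one at [Ugen x * u]. *)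
have kb : bilin (fun f1 f2 =>
    \sw_(x0, x1 <- rho x) (act x0 f1 \ox (x1 * f2)) + f1 \ox act x f2 : tensor F F).
  by mlin.
rewrite (sweedler_comp _ _ (sweedler_linear kb)) sw_comult_Ugen; last by mlin.
apply: eq_sw => u1 u2.
rewrite (sweedler_comp _ _ (sweedler_linear kb)) swRhoM; last by mlin.
rewrite [X in _ = X + _ + _]sweedler_exchange -!sweedler_add; apply: eq_sw => u10 u11.
rewrite (sweedler_comp _ _ (sweedler_linear kb)).
rewrite [X in _ = X + _ + _]sweedler_exchange -!sweedler_add; apply: eq_sw => f1 f2.
rewrite (sweedler_pure kb) actD (linD (linear_pure _)) !ActM addrA; congr (_ + _ + _).
by apply: eq_sw => x0 x1; rewrite ActM mulrA.
Qed.

(** U(g) is cocommutative and F is commutative. *)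
Lemma ext_compat u f :
  \sw_(u1, u2 <- comult u) \sw_(u20, u21 <- Rho u2) (u20 \ox (Act u1 f * u21)) =
  \sw_(u1, u2 <- comult u) \sw_(u10, u11 <- Rho u1) (u10 \ox (u11 * Act u2 f)).
Proof.
rewrite [LHS]Ug_cocomm; last by mlin.
by apply: eq_sw => u1 u2; apply: eq_sw => u10 u11; rewrite mulrC.
Qed.

Lemma ext_matched_pair : matched_pair Act Rho.
Proof.
split.
- exact: Act_mod.
- exact: ext_module_alg1.
- exact: ext_module_algM.
- split; [exact: Rho_l|exact: ext_coactA|exact: ext_coact_counit].
- exact: ext_comodule_coalg.
- exact: ext_comodule_counit.
- exact: ext_counit.
- exact: ext_comult.
- exact: Rho1.
- exact: ext_coactM ext.
- exact: ext_compat.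
Qed.

End MatchedPair.

(** In the converse [Rho] takes values in the tensor product of U(g) and F; that it maps g into the
    tensor product of g and F is part of the claim, expressed by [coact_on_gen]. *)
Theorem theorem2p6 (R : realType) (g : finLieAlgType R[i]) (F : comHopfAlgType R[i]) :
  (forall (act : g -> F -> F) (rho : g -> tensor g F),
     g_Hopf act rho ->
     (exists (Act : Ug g -> F -> F) (Rho : Ug g -> tensor (Ug g) F),
        extends_to_Ug act rho Act Rho) /\
     (forall (Act : Ug g -> F -> F) (Rho : Ug g -> tensor (Ug g) F),
        extends_to_Ug act rho Act Rho -> matched_pair Act Rho)) /\
  (forall (Act : Ug g -> F -> F) (Rho : Ug g -> tensor (Ug g) F),
     matched_pair Act Rho ->
     exists rho : g -> tensor g F,
       coact_on_gen rho Rho /\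
       g_Hopf (fun (X : g) (f : F) => Act (env_gen X) f) rho).
Proof.
split=> [act rho gH|Act Rho mp].
  split=> [|Act Rho]; last exact: ext_matched_pair gH.
  by exists (ext_action act), (ext_coaction act rho); apply: ext_exists.
have char0 : [pchar R[i]] =i pred0 by apply: Num.Theory.pchar_num.
exists (restr_coact Rho); split; last exact: matched_pair_g_Hopf char0 mp.
by move=> x; apply: matched_coact_Ugen char0 mp x.
Qed.
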